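(* Let $E$ be an elliptic curve over $K=\mathbb{F}_q$ with function field $K(E)=K(x,y)$ and distinguished rational place $Q_\infty$, as in the context, and let $P$ be a rational place of $K(E)$. For an integer $n\ge1$, $n{\bf P}={\bf Q}_\infty$ if and only if $$\mathcal{L}(nP-nQ_\infty)=\mathrm{span}_K\{F({\bf P},{\bf P})F({\bf P},2{\bf P})\cdots F({\bf P},(n-1){\bf P})\}.$$
   Context: $K=\mathbb{F}_q$ and $K(E)=K(x,y)$ is a function field of genus $1$ with full constant field $K$, where either $\mathrm{char}K\ne2$ and $y^2=f(x)$ with $f\in K[x]$ square-free of degree $3$, or $\mathrm{char}K=2$ and either $y^2+y=f(x)$ with $\deg f=3$, or $y^2+y=x+\frac{1}{ax+b}$ with $a,b\in K$, $a\neq0$. $Q_\infty$ denotes the unique common pole of $x$ and $y$; it is a rational place. $\mathcal{L}(D)$ is the Riemann–Roch space of a divisor $D$. The map $P\mapsto[P-Q_\infty]$ from rational places to the degree-zero divisor class group is a bijection and induces an abelian group structure (the elliptic curve group law) with identity $Q_\infty$. For a rational place $P$, ${\bf P}$ denotes the corresponding point of $E$; ${\bf P}+{\bf Q}$ and $k{\bf P}$ denote operations in this group (whereas $nP$ denotes a divisor), ${\bf Q}_\infty$ is the identity, and $P'$ denotes the place of $-{\bf P}$. For rational places $P,Q\neq Q_\infty$, $m({\bf P},{\bf Q})$ denotes a (any) linear polynomial $ax+by+c$ ($a,b,c\in K$ not all zero) whose zero set is the line through ${\bf P},{\bf Q}$ (the tangent line at ${\bf P}$ if $P=Q$; a nonzero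 multiple of $x-x({\bf P})$ if $Q=P'$). Writing ${\bf R}={\bf P}+{\bf Q}$, define $F({\bf P},{\bf Q})=\frac{x-x({\bf R})}{m({\bf P},{\bf Q})}$ if ${\bf P},{\bf Q},{\bf R}\neq{\bf Q}_\infty$; $F({\bf P},{\bf Q})=\frac{1}{m({\bf P},{\bf Q})}$ if ${\bf P},{\bf Q}\neq{\bf Q}_\infty$ but ${\bf R}={\bf Q}_\infty$; and $F({\bf P},{\bf Q})=1$ if ${\bf P}={\bf Q}_\infty$ or ${\bf Q}={\bf Q}_\infty$. For $n=1$ the product is empty and equals $1$.
   Formalization: For the third equation y^2+y=x+1/(ax+b), the lines m(P,Q) are linear polynomials in x and (ax+b)y instead of x and y; with y itself the claim fails, e.g. for n=3 and a point P of order 3 over F_4. *)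

(* Defs.v *)
From HB Require Import structures.
From mathcomp Require Import all_boot all_order all_algebra all_field.
From mathcomp Require Import boolp classical_sets.
From mathcomp.multinomials Require Import freeg.

Set Implicit Arguments.
Unset Strict Implicit.
Unset Printing Implicit Defensive.

Import Order.TTheory GRing.Theory Num.Theory.

Local Open Scope ring_scope.
Local Open Scope classical_set_scope.

(* An algebraic function field of one variable over K is presented as a finite
   extension L of the field K(X) of rational functions.  The element x of L is
   the image of the variable X, so it is transcendental over K. *)
Section FunctionField.
Variables (K : finFieldType) (L : fieldExtType {fraction {poly K}}).

Definition ratfun (p : {poly K}) : L := (tofrac p)%:A.
Definition const (c : K) : L := ratfun c%:P.
Definition varx : L := ratfun 'X.

(* Places are identified with their normalized discrete valuations.  The value
   at 0 (which should be +oo) is a junk value, fixed so that a place is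
   determined by its valuation on nonzero elements. *)
Record place : Type := Place {
  pval : L -> int;
  _ : pval 0 = 0;
  _ : forall c : K, c != 0 -> pval (const c) = 0;
  _ : forall u v : L, u != 0 -> v != 0 -> pval (u * v) = pval u + pval v;
  _ : forall u v : L, u != 0 -> v != 0 -> u + v != 0 ->
        Num.min (pval u) (pval v) <= pval (u + v);
  _ : exists2 t : L, t != 0 & pval t = 1
}.

HB.instance Definition _ := gen_eqMixin place.
HB.instance Definition _ := gen_choiceMixin place.

Definition in_valuation_ring (P : place) (u : L) : Prop :=
  u = 0 \/ 0 <= pval P u.

Definition in_maximal_ideal (P : place) (u : L) : Prop :=
  u = 0 \/ 0 < pval P u.

(* degree one: the residue field is K *)
Definition rational (P : place) : Prop :=
  forall u : L, in_valuation_ring P u ->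
    exists c : K, in_maximal_ideal P (u - const c).

(* u(P), for P rational and u regular at P *)
Definition value_at (P : place) (u : L) : K :=
  xget 0 [set c : K | in_maximal_ideal P (u - const c)].

Definition divisor := {freeg place / int}.

Definition principal (D : divisor) : Prop :=
  exists2 u : L, u != 0 & forall P : place, coeff P D = pval P u.

Definition lin_equiv (D1 D2 : divisor) : Prop := principal (D1 - D2).

Definition riemann_roch (D : divisor) : set L :=
  [set u | u = 0 \/ forall P : place, - coeff P D <= pval P u].

Definition Kspan1 (g : L) : set L := [set const c * g | c in [set: K]].

(* The group law on rational places with identity Q, transported from the
   degree-zero divisor class group along P |-> [P - Q]. *)
Section GroupLaw.
Variable Q : place.

Definition pclass (P : place) : divisor := << P >> - << Q >>.

Definition padd (P1 P2 : place) : place :=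
  xget Q [set R | rational R /\
                  lin_equiv (pclass P1 + pclass P2) (pclass R)].

Definition pmul (k : nat) (P : place) : place := iter k (padd P) Q.

End GroupLaw.
End FunctionField.

Definition square_free (F : fieldType) (f : {poly F}) : Prop :=
  forall g : {poly F}, (1 < size g)%N -> ~~ (g ^+ 2 %| f).

Variant curve_equation (K : fieldType) : Type :=
| SquareEq of {poly K}        (* y^2 = f(x) *)
| ArtinSchreierEq of {poly K} (* y^2 + y = f(x) *)
| PoleEq of K & K.            (* y^2 + y = x + 1/(ax + b) *)

Definition admissible (K : fieldType) (E : curve_equation K) : Prop :=
  match E with
  | SquareEq f => [/\ 2%N \notin [pchar K], size f = 4%N & square_free f]
  | ArtinSchreierEq f => 2%N \in [pchar K] /\ size f = 4%N
  | PoleEq a b => 2%N \in [pchar K] /\ a != 0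
  end.

(* Lines are taken in a plane model w^2 + h(x) w = g(x) whose point at infinity
   Q_oo is a flex, so that three collinear points add up to zero in the group
   with identity Q_oo.  In the first two cases w = y.  The curve
   y^2 + y = x + 1/(ax + b) is not of this form (at infinity it has two places,
   Q_oo and the place over ax + b = 0, and chords do not give the group law with
   identity Q_oo); clearing denominators gives w = (ax + b) y. *)
Definition w_factor (K : fieldType) (E : curve_equation K) : {poly K} :=
  if E is PoleEq a b then a *: 'X + b%:P else 1.

Definition weier_h (K : fieldType) (E : curve_equation K) : {poly K} :=
  match E with
  | SquareEq _ => 0
  | ArtinSchreierEq _ => 1
  | PoleEq a b => a *: 'X + b%:P
  end.

Definition weier_g (K : fieldType) (E : curve_equation K) : {poly K} :=
  match E with
  | SquareEq f => f
  | ArtinSchreierEq f => f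
  | PoleEq a b => 'X * (a *: 'X + b%:P) ^+ 2 + (a *: 'X + b%:P)
  end.

Section EllipticFunctionField.
Variables (K : finFieldType) (L : fieldExtType {fraction {poly K}}).
Variables (E : curve_equation K) (y : L).

Local Notation x := (varx L).

Definition satisfies_equation : Prop :=
  match E with
  | SquareEq f => y ^+ 2 = ratfun L f
  | ArtinSchreierEq f => y ^+ 2 + y = ratfun L f
  | PoleEq a b => y ^+ 2 + y = x + (const L a * x + const L b)^-1
  end.

(* L = K(x, y) with y subject to one of the three equations; the genus is then
   1 and the full constant field is K. *)
Definition elliptic_function_field : Prop :=
  [/\ admissible E, satisfies_equation & <<1; y>>%VS = fullv].

Definition common_pole (Q : place L) : Prop := pval Q x < 0 /\ pval Q y < 0.

Definition coord_w : L := ratfun L (w_factor E) * y.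

(* The linear form a x + b w + c vanishes at the point of P. *)
Definition passes_through (a b c : K) (P : place L) : Prop :=
  a * value_at P x + b * value_at P coord_w + c = 0.

(* (a, b) is proportional to the gradient of w^2 + h(x) w - g(x) at P. *)
Definition tangent_direction (a b : K) (P : place L) : Prop :=
  let x0 := value_at P x in
  let w0 := value_at P coord_w in
  a * (w0 *+ 2 + (weier_h E).[x0]) =
  b * ((weier_h E)^`().[x0] * w0 - (weier_g E)^`().[x0]).

Section Lines.
Variable Qoo : place L.

(* l is a possible value of m(P, Q). *)
Definition is_line (P Q : place L) (l : L) : Prop :=
  exists a b c : K,
    [/\ l = const L a * x + const L b * coord_w + const L c,
        (a, b, c) != (0, 0, 0)
      & if padd Qoo P Q == Qoo then b = 0 /\ c = - a * value_at P x
        else if P == Q then passes_through a b c P /\ tangent_direction a b P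
        else passes_through a b c P /\ passes_through a b c Q].

Definition line_choice (m : place L -> place L -> L) : Prop :=
  forall P Q : place L, rational P -> rational Q -> P <> Qoo -> Q <> Qoo ->
    is_line P Q (m P Q).

Definition Ffun (m : place L -> place L -> L) (P Q : place L) : L :=
  let R := padd Qoo P Q in
  if (P == Qoo) || (Q == Qoo) then 1
  else if R == Qoo then (m P Q)^-1
  else (x - const L (value_at R x)) / m P Q.

End Lines.
End EllipticFunctionField.

(* Main.v *)
(* The divisor of F(P, Q) is (P + Q) + Qoo - P - Q, so the product of the
   F(P, kP) for k < n telescopes to a function G with divisor
   (nP) + (n - 1) Qoo - n P.  If nP = Qoo this is n Qoo - n P, and u / G has no
   pole for any u in L(n P - n Qoo), hence is constant; conversely, membership
   of G in that space forces a zero of order n at Qoo, that is nP = Qoo.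

   All three equations have a smooth model w^2 + h w = g with deg h <= 1 and
   deg g = 3.  There is a single place over x = oo, where a + b w has a pole of
   order max(2 deg a, 2 deg b + 3).  Smoothness makes the primes of
   K[x] + K[x] w locally principal, and the places constructed from them show
   that a function regular away from Qoo lies in this ring.  Such a function
   never has a simple pole at Qoo, so distinct rational places are not linearly
   equivalent, and the sum of two of them can be read off the divisor of a
   line. *)
Require Import Defs.
From HB Require Import structures.
From mathcomp Require Import all_boot all_order all_algebra all_field.
From mathcomp Require Import boolp classical_sets.
From mathcomp.multinomials Require Import freeg.
From mathcomp Require Import zify ring.

Set Implicit Arguments.
Unset Strict Implicit.
Unset Printing Implicit Defensive.

Import Order.TTheory GRing.Theory Num.Theory.

(** The genus shows in the pole orders at [Qoo]. There x and w have orders 2 and 3, so the two terms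
    of a + b w have orders of different parity and cannot cancel, and the order 1 never occurs. This
    gap is what makes the group law well defined. The obstacle lies on the affine side. Membership
    in a Riemann-Roch space speaks about valuations, and gives algebraic information only if there
    are enough of them: the primes of K[x] + K[x] w, rational or not, must be shown to carry places.
    These valuations are built as orders with respect to a local generator; instead of forming a
    localization, each identity carries multipliers lying outside the prime. Since [padd] is a
    choice made by [xget], a sum is always identified by exhibiting a function with the expected
    divisor, and the lines provide such functions. Values at 0 are junk, so most bounds go through
    [vge], for which 0 belongs to every power of the maximal ideal. *)

Local Open Scope ring_scope.
(* [lia] compares atoms syntactically, whereas values of a place often differ
   by the canonical structures through which their argument is inferred. *)
Ltac plia :=
  repeat match goal with H : context [pval _ _] |- _ => revert H end;
  repeat match goal with |- context [pval ?P ?u] => move: (pval P u) => ? end;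
  lia.

(** * Valuations at places *)

Section Places.
Variables (K : finFieldType) (L : fieldExtType {fraction {poly K}}).
Implicit Types (P : place L) (u v : L) (n : int) (a b : {poly K}).

HB.instance Definition _ :=
  GRing.RMorphism.copy (ratfun L) (in_alg L \o @FracField.tofrac {poly K}).

Lemma ratfun_eq0 a : (ratfun L a == 0) = (a == 0).
Proof. by rewrite /ratfun scaler_eq0 oner_eq0 orbF tofrac_eq0. Qed.

Lemma ratfunM a b : ratfun L (a * b) = ratfun L a * ratfun L b.
Proof. exact: rmorphM. Qed.

Lemma const_eq0 (c : K) : (const L c == 0) = (c == 0).
Proof. by rewrite ratfun_eq0 polyC_eq0. Qed.

Lemma pval0 P : pval P 0 = 0. Proof. by case: P. Qed.

Lemma pval_const P (c : K) : pval P (const L c) = 0.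
Proof.
have [->|c0] := eqVneq c 0; last by case: P => /= f _ /(_ c c0).
by rewrite /const polyC0 rmorph0 pval0.
Qed.

Lemma pvalM P u v : u != 0 -> v != 0 -> pval P (u * v) = pval P u + pval P v.
Proof. by case: P => /= f _ _ H _ _; apply: H. Qed.

Lemma pvalD P u v : u != 0 -> v != 0 -> u + v != 0 ->
  Num.min (pval P u) (pval P v) <= pval P (u + v).
Proof. by case: P => /= f _ _ _ H _; apply: H. Qed.

Lemma pval_uniformizer P : exists2 t, t != 0 & pval P t = 1.
Proof. by case: P. Qed.

Lemma pval1 P : pval P 1 = 0.
Proof. by have := pvalM P (oner_neq0 L) (oner_neq0 L); rewrite mulr1; plia. Qed.

Lemma pvalX P u (k : nat) : u != 0 -> pval P (u ^+ k) = pval P u * k%:Z.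
Proof.
move=> u0; elim: k => [|k IH]; first by rewrite expr0 pval1 mulr0.
by rewrite exprS pvalM ?expf_neq0 // IH; plia.
Qed.

Lemma pvalV P u : pval P u^-1 = - pval P u.
Proof.
have [->|u0] := eqVneq u 0; first by rewrite invr0 pval0.
by have := pvalM P u0 (invr_neq0 u0); rewrite divff // pval1; plia.
Qed.

Lemma pval_div P u v : u != 0 -> v != 0 -> pval P (u / v) = pval P u - pval P v.
Proof. by move=> u0 v0; rewrite pvalM ?invr_eq0 // pvalV. Qed.

Lemma pvalXz P u (k : int) : u != 0 -> pval P (u ^ k) = pval P u * k.
Proof.
by move=> u0; case: k => k; rewrite ?NegzE -?exprnP ?exprnN ?pvalV pvalX //; plia.
Qed.

Lemma pvalN P u : pval P (- u) = pval P u.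
Proof.
have [->|u0] := eqVneq u 0; first by rewrite oppr0.
have N10 : -1 != 0 :> L by rewrite oppr_eq0 oner_eq0.
have := pvalM P N10 N10; rewrite mulrNN mulr1 pval1 => h.
by rewrite -mulN1r pvalM //; plia.
Qed.

(* [u] lies in the [n]-th power of the maximal ideal of [P]. *)
Definition vge P n u := u = 0 \/ n <= pval P u.

Lemma vgeE P n u : u != 0 -> vge P n u <-> n <= pval P u.
Proof. by move/eqP=> u0; split=> [[]|]//; right. Qed.

Lemma vge_le P n n' u : n' <= n -> vge P n u -> vge P n' u.
Proof. by move=> le [->|h]; [left|right; lia]. Qed.

Lemma vgeD P n u v : vge P n u -> vge P n v -> vge P n (u + v).
Proof.
case=> [->|hu]; first by rewrite add0r.
case=> [->|hv]; first by rewrite addr0; right.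
have [->|u0] := eqVneq u 0; first by rewrite add0r; right.
have [->|v0] := eqVneq v 0; first by rewrite addr0; right.
have [->|uv0] := eqVneq (u + v) 0; first by left.
by right; apply: le_trans (pvalD P u0 v0 uv0); rewrite le_min hu hv.
Qed.

Lemma vgeN P n u : vge P n (- u) <-> vge P n u.
Proof.
rewrite /vge pvalN; split=> [] [h|]; try by right.
  by left; rewrite -(opprK u) h oppr0.
by left; rewrite h oppr0.
Qed.

Lemma vgeB P n u v : vge P n u -> vge P n v -> vge P n (u - v).
Proof. by move=> hu hv; apply: vgeD => //; apply/vgeN. Qed.

Lemma vgeM P n n' u v : vge P n u -> vge P n' v -> vge P (n + n') (u * v).
Proof.
case=> [->|hu]; first by rewrite mul0r; left.
case=> [->|hv]; first by rewrite mulr0; left.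
have [->|u0] := eqVneq u 0; first by rewrite mul0r; left.
have [->|v0] := eqVneq v 0; first by rewrite mulr0; left.
by right; rewrite pvalM // lerD.
Qed.

Lemma vge0M P n u v : vge P 0 u -> vge P n v -> vge P n (u * v).
Proof. by move=> hu hv; rewrite -[n]add0r; apply: vgeM. Qed.

Lemma vge_const P (c : K) : vge P 0 (const L c).
Proof. by right; rewrite pval_const. Qed.

Lemma vge1_const P (c : K) : vge P 1 (const L c) -> c = 0.
Proof. by case=> [/eqP|]; rewrite ?const_eq0 ?pval_const // => /eqP. Qed.

Lemma vge1_1 P : ~ vge P 1 1.
Proof. by case=> [/eqP|]; rewrite ?oner_eq0 ?pval1. Qed.

(** The strict case of the ultrametric inequality: u = (u + v) - v would otherwise have too large a
    value. That the sum is nonzero has to be part of the conclusion, because the junk value at 0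
    could not exclude it. *)
Lemma pval_add_lt P u v : u != 0 -> vge P (pval P u + 1) v ->
  u + v != 0 /\ pval P (u + v) = pval P u.
Proof.
move=> u0 hv.
have nv : ~ vge P (pval P u + 1) u by rewrite vgeE //; plia.
have uv0 : u + v != 0.
  apply/eqP => h; apply: nv; have E : u = - v by apply/eqP; rewrite -addr_eq0 h.
  by rewrite [X in vge _ _ X]E; apply/vgeN.
split=> //; apply/eqP; rewrite eq_le; apply/andP; split.
  rewrite leNgt; apply/negP => h; apply: nv.
  have E : u = (u + v) - v by rewrite addrK.
  by rewrite [X in vge _ _ X]E; apply: vgeB => //; right; plia.
apply/(vgeE _ _ uv0); apply: vgeD; first by right.
by apply: vge_le hv; plia.
Qed.

Lemma place_inj P P' : pval P = pval P' -> P = P'.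
Proof.
case: P => f h1 h2 h3 h4 h5; case: P' => f' h1' h2' h3' h4' h5' /= E.
by move: h1' h2' h3' h4' h5'; rewrite -E => *; congr Place; apply: Prop_irrelevance.
Qed.

(* The values of two places that are proportional to the same function agree,
   since both are normalized. *)
Lemma place_eq_proportional P P' (e e' : int) : 0 < e -> 0 < e' ->
  (forall u, u != 0 -> exists k : int, pval P u = e * k /\ pval P' u = e' * k) ->
  P = P'.
Proof.
move=> e0 e0' H; apply: place_inj; apply/funext => u.
have [t t0 tP] := pval_uniformizer P; have [t' t0' tP'] := pval_uniformizer P'.
have [k [hk _]] := H t t0; have [k' [_ hk']] := H t' t0'.
have [->|u0] := eqVneq u 0; first by rewrite !pval0.
have [j [-> ->]] := H u u0.
have e1 (d j' : int) : 0 < d -> 1 = d * j' -> d = 1.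
  move=> d0 E; have : (d %| 1)%Z by apply/dvdzP; exists j'; rewrite mulrC.
  by rewrite dvdz1 => /eqP; lia.
have -> : e = 1 by apply: (e1 e k) => //; rewrite -hk.
by have -> : e' = 1 by apply: (e1 e' k') => //; rewrite -hk'.
Qed.

Lemma ratfun_poly_ind (S : L -> Prop) :
  (forall c, S (const L c)) ->
  (forall u v, S u -> S v -> S (u + v)) -> (forall u v, S u -> S v -> S (u * v)) ->
  S (varx L) -> forall a, S (ratfun L a).
Proof.
move=> Sc SD SM Sx; elim/poly_ind => [|a c IH].
  by rewrite rmorph0 -(rmorph0 (ratfun L)); apply: (Sc 0).
by rewrite rmorphD rmorphM /=; apply: SD (Sc c); apply: SM.
Qed.

Lemma vge0_ratfun P a : vge P 0 (varx L) -> vge P 0 (ratfun L a).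
Proof.
move=> hx; apply: ratfun_poly_ind => // [c|u v hu hv|u v hu hv].
- exact: vge_const.
- exact: vgeD.
- exact: vge0M.
Qed.

Lemma pole_ratfun P a : pval P (varx L) < 0 -> a != 0 ->
  pval P (ratfun L a) = pval P (varx L) * (size a).-1%:Z.
Proof.
move=> xneg; have x0 : varx L != 0 by rewrite ratfun_eq0 polyX_eq0.
elim/poly_ind: a => [|a c IH]; rewrite ?eqxx // size_MXaddC => ac0.
rewrite rmorphD rmorphM /=.
have [a0|a0] := eqVneq a 0.
  rewrite a0 rmorph0 mul0r add0r; move: ac0; rewrite a0 mul0r add0r polyC_eq0.
  by move=> /negbTE ->; rewrite (pval_const P c) size_poly0 mulr0.
have s0 : (0 < size a)%N by rewrite size_poly_gt0.
have ra0 : ratfun L a != 0 by rewrite ratfun_eq0.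
have h : pval P (ratfun L a * varx L) = pval P (varx L) * (size a)%:Z.
  by rewrite pvalM // IH //; case: (size a) s0 => //= k _; plia.
have [] := @pval_add_lt P (ratfun L a * varx L) (const L c).
- by rewrite mulf_neq0.
- by apply: vge_le (vge_const P c); rewrite h; nia.
by move=> _; rewrite /= h.
Qed.

End Places.

(** * Irreducible factors of polynomials *)

Section PolyFacts.
Variable K : fieldType.
Implicit Types (p q a b d : {poly K}).

Lemma irredp_dvdM p a b :
  irreducible_poly p -> p %| a * b -> (p %| a) || (p %| b).
Proof.
move=> irr; have [//|npa] := boolP (p %| a).
by rewrite Gauss_dvdpr // irreducible_poly_coprime.
Qed.

Lemma irredp_ndvd1 p : irreducible_poly p -> ~~ (p %| 1).
Proof. by move=> [sp _]; rewrite dvdp1; lia. Qed.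

Lemma irredp_factor d : (1 < size d)%N -> exists2 p, irreducible_poly p & p %| d.
Proof.
have [n] := ubnP (size d); elim: n d => // n IH d lt d1.
have [irr|] := pselect (irreducible_poly d); first by exists d.
move=> nirr; have [q [q1 qd nqd]] : exists q, [/\ size q != 1%N, q %| d & ~~ (q %= d)].
  apply: contrapT => H; apply: nirr; split=> // q q1 qd.
  by apply/negPn/negP => nq; apply: H; exists q.
have d0 : d != 0 by rewrite -size_poly_gt0; lia.
have q0 : q != 0 by apply: contraTneq qd => ->; rewrite dvd0p.
have sq : (0 < size q)%N by rewrite size_poly_gt0.
have sqd : (size q < size d)%N.
  by rewrite ltn_neqAle (dvdp_leq d0 qd) andbT dvdp_size_eqp.
have [||p irr pq] := IH q; [by lia|by lia|].
by exists p => //; apply: dvdp_trans qd.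
Qed.

Lemma irredp_multiplicity p a : irreducible_poly p -> a != 0 ->
  exists j b, a = p ^+ j * b /\ ~~ (p %| b).
Proof.
move=> irr; have [n] := ubnP (size a); elim: n a => // n IH a lt a0.
have [|np] := boolP (p %| a); last by exists 0%N, a; rewrite expr0 mul1r.
move=> /dvdpP [q E]; have q0 : q != 0 by apply: contraNneq a0 => q0; rewrite E q0 mul0r.
have p0 := irredp_neq0 irr; have [p1 _] := irr.
have [||j [b [Eq nb]]] := IH q => //.
  have := size_mul q0 p0; rewrite -E.
  have : (0 < size q)%N by rewrite size_poly_gt0.
  by move: lt p1; move: (size q) (size p) (size a) => i k l; lia.
by exists j.+1, b; split=> //; rewrite E Eq exprS; ring.
Qed.

End PolyFacts.

Lemma fraction_ratio (R : idomainType) (f : {fraction R}) :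
  exists n d : R, d != 0 /\ f * FracField.tofrac d = FracField.tofrac n.
Proof.
elim/quotW: f => f; exists (frac f).1, (frac f).2; split; first exact: denom_ratioP.
unlock FracField.tofrac; rewrite -[LHS]FracField.pi_mul; apply/eqmodP.
rewrite /= FracField.equivfE /FracField.mulf.
by rewrite !numden_Ratio ?(oner_eq0, mulf_neq0, denom_ratioP) // !mulr1 mulrC.
Qed.

(** * Weierstrass models *)

Section Weierstrass.
Variables (K : finFieldType) (L : fieldExtType {fraction {poly K}}).
Variables (h g : {poly K}) (w : L) (Qoo : place L).
Implicit Types (P : place L) (u v : L) (n : int) (a b p d : {poly K}).

Local Notation x := (varx L).

Hypothesis w_eq : w ^+ 2 + ratfun L h * w = ratfun L g.
Hypothesis size_h : (size h <= 2)%N.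
Hypothesis size_g : size g = 4%N.
Hypothesis Qoo_pole : pval Qoo x < 0.

Definition el a b : L := ratfun L a + ratfun L b * w.

Lemma el0r a : el a 0 = ratfun L a.
Proof. by rewrite /el rmorph0 mul0r addr0. Qed.

Lemma el1 : el 1 0 = 1.
Proof. by rewrite el0r rmorph1. Qed.

Lemma elB a b a' b' : el a b - el a' b' = el (a - a') (b - b').
Proof. by rewrite /el !rmorphB; ring. Qed.

Lemma elZ d a b : el (d * a) (d * b) = ratfun L d * el a b.
Proof. by rewrite /el !ratfunM; ring. Qed.

Lemma elD a b a' b' : el a b + el a' b' = el (a + a') (b + b').
Proof. by rewrite /el !rmorphD; ring. Qed.

Lemma elM a b a' b' : el a b * el a' b' =
  el (a * a' + b * b' * g) (a * b' + b * a' - b * b' * h).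
Proof.
rewrite /el !(rmorphM, rmorphD, rmorphB) /= -w_eq; ring.
Qed.

(* The conjugate of [w] is [- h - w]. *)
Definition elnorm a b : {poly K} := a ^+ 2 - a * b * h - b ^+ 2 * g.

Lemma el_conj a b : el a b * el (a - b * h) (- b) = ratfun L (elnorm a b).
Proof. by rewrite elM -el0r; congr el; rewrite /elnorm; ring. Qed.

(** Since deg g = 3 and deg h <= 1, w has a worse pole than x, so w^2 dominates h w and 2 v(w) = 3
    v(x). Hence e = v(x) - v(w). That e = 1 at [Qoo] is known only once every function is expressed
    through x and w. *)
Lemma pole_w P : pval P x < 0 ->
  exists2 e : int, 0 < e & pval P x = - (2 * e) /\ pval P w = - (3 * e).
Proof.
move=> xneg.
have g0 : g != 0 by rewrite -size_poly_gt0 size_g.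
have rg : pval P (ratfun L g) = pval P x * 3 by rewrite pole_ratfun // size_g.
have w0 : w != 0.
  apply/eqP => w0; move: w_eq; rewrite w0 mulr0 addr0 expr0n /= => /esym/eqP.
  by rewrite ratfun_eq0 (negbTE g0).
have rh : vge P (pval P x) (ratfun L h).
  have [->|h0] := eqVneq h 0; first by left; rewrite rmorph0.
  right; rewrite pole_ratfun //; move: size_h; case: (size h) => [|[|[|]]] //=; nia.
have hw : pval P w < pval P x.
  rewrite ltNge; apply/negP => hge.
  have : vge P (pval P x + pval P x) (ratfun L g).
    rewrite -w_eq expr2; apply: vgeD; apply: vgeM => //; right => //.
  case=> [/eqP|]; first by rewrite ratfun_eq0 (negbTE g0).
  by rewrite rg; plia.
have w20 : w ^+ 2 != 0 by rewrite expf_neq0.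
have [] := @pval_add_lt _ _ P (w ^+ 2) (ratfun L h * w) w20.
  apply: (@vge_le _ _ _ (pval P x + pval P w)); first by rewrite pvalX //; plia.
  by apply: vgeM => //; right.
rewrite w_eq rg pvalX // => _ E.
by exists (pval P x - pval P w); [|split]; plia.
Qed.

(* Minus the valuation of [a + b w] at infinity. *)
Definition degw a b : nat :=
  (maxn (2 * size a) (if b == 0%R then 0 else 2 * size b + 3) - 2)%N.

(** The terms a and b w have pole orders 2 e deg a and e (2 deg b + 3), which differ by parity, so
    the larger one is the order of the sum. *)
Lemma pole_el P (e : int) a b : 0 < e ->
  pval P x = - (2 * e) -> pval P w = - (3 * e) -> (a, b) != (0, 0) ->
  el a b != 0 /\ pval P (el a b) = e * - (degw a b)%:Z.
Proof.
move=> e0 xe we ab0.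
have xneg : pval P x < 0 by rewrite xe; lia.
have w0 : w != 0 by apply/eqP => w0; move: we; rewrite w0 pval0; lia.
have pa c : c != 0 -> pval P (ratfun L c) = - (2 * e) * (size c).-1%:Z.
  by move=> c0; rewrite pole_ratfun // xe.
have s0 (c : {poly K}) : c != 0 -> (0 < size c)%N by rewrite size_poly_gt0.
rewrite /degw; have [b0|b0] := eqVneq b 0.
  move: ab0; rewrite b0 xpair_eqE eqxx andbT => a0.
  rewrite el0r ratfun_eq0; split=> //; rewrite pa //; have := s0 a a0.
  by case: (size a) => //= k _; rewrite maxn0; nia.
have rb0 : ratfun L b != 0 by rewrite ratfun_eq0.
have pb : pval P (ratfun L b * w) = - (2 * e) * (size b).-1%:Z - 3 * e.
  by rewrite pvalM // we pa.
have rbw0 : ratfun L b * w != 0 by rewrite mulf_neq0.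
have sb := s0 b b0.
have [a0|a0] := eqVneq a 0.
  rewrite /el a0 rmorph0 add0r size_poly0 max0n; split=> //; rewrite pb.
  by case: (size b) sb => //= k _; nia.
have sa := s0 a a0; have ra0 : ratfun L a != 0 by rewrite ratfun_eq0.
(* In terms of degrees this is deg b + 2 <= deg a, that is, 2 deg b + 3 < 2 deg a. *)
rewrite /el; have [lt|lt] := leqP (size b).+1 (size a).-1.
  have [] := @pval_add_lt _ _ P _ (ratfun L b * w) ra0.
    right; rewrite pb pa //; case: (size b) (size a) lt sb sa => [|k] [|l] //=; nia.
  move=> -> ->; split=> //; rewrite pa //.
  by case: (size b) (size a) lt sb sa => [|k] [|l] //= lt _ _; rewrite (maxn_idPl _); nia.
rewrite addrC; have [] := @pval_add_lt _ _ P _ (ratfun L a) rbw0.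
  right; rewrite pb pa //; case: (size b) (size a) lt sb sa => [|k] [|l] //=; nia.
move=> -> ->; split=> //; rewrite pb //.
by case: (size b) (size a) lt sb sa => [|k] [|l] //= lt _ _; rewrite (maxn_idPr _); nia.
Qed.

(** Independence of 1 and w over K(x) is read off at [Qoo], where every a + b w with (a, b) nonzero
    has a definite order. *)
Lemma el_eq0 a b : el a b = 0 -> a = 0 /\ b = 0.
Proof.
move=> E; have [e e0 [xe we]] := pole_w Qoo_pole.
have [/eqP|/(pole_el e0 xe we) []] := eqVneq (a, b) (0, 0).
  by rewrite xpair_eqE => /andP[/eqP-> /eqP->].
by rewrite E eqxx.
Qed.

Lemma el_inj a b a' b' : el a b = el a' b' -> a = a' /\ b = b'.
Proof.
by move/eqP; rewrite -subr_eq0 elB => /eqP/el_eq0 [/eqP + /eqP];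
  rewrite !subr_eq0 => /eqP -> /eqP ->.
Qed.

Lemma elnorm_eq0 a b : elnorm a b = 0 -> a = 0 /\ b = 0.
Proof.
move=> N0; have := el_conj a b; rewrite N0 rmorph0 => /eqP.
rewrite mulf_eq0 => /orP[] /eqP /el_eq0 // [/eqP + /eqP].
by rewrite oppr_eq0 => + /eqP b0; rewrite b0 mul0r subr0 => /eqP.
Qed.

Hypothesis el_gen : forall u, exists a b d, d != 0 /\ u = el a b / ratfun L d.

(** At any pole of x the value of (a + b w) / d is a positive constant times the same integer, built
    from [degw], so [place_eq_proportional] applies. *)
Lemma pole_unique P : pval P x < 0 -> P = Qoo.
Proof.
move=> Ppole; have [e e0 [xe we]] := pole_w Ppole.
have [e' e0' [xe' we']] := pole_w Qoo_pole.
apply: (place_eq_proportional e0 e0') => u u0.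
have [a [b [d [d0 E]]]] := el_gen u.
have d00 : (d, 0) != (0, 0) :> {poly K} * {poly K} by rewrite xpair_eqE (negbTE d0).
have ab0 : (a, b) != (0, 0).
  by apply: contraNneq u0 => -[a0 b0]; rewrite E a0 b0 el0r rmorph0 mul0r.
have [n0 vn] := pole_el e0 xe we ab0; have [_ vn'] := pole_el e0' xe' we' ab0.
have [m0 vm] := pole_el e0 xe we d00; have [_ vm'] := pole_el e0' xe' we' d00.
exists (- (degw a b)%:Z + (degw d 0)%:Z).
by rewrite E -el0r !pval_div // vn vn' vm vm'; lia.
Qed.

(** All values at [Qoo] are multiples of e, and a uniformizer has value 1. *)
Lemma Qoo_values : pval Qoo x = -2 /\ pval Qoo w = -3.
Proof.
have [e e0 [xe we]] := pole_w Qoo_pole.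
suff e1 : e = 1 by rewrite xe we e1.
have [t t0 tE] := pval_uniformizer Qoo; have [a [b [d [d0 E]]]] := el_gen t.
have d00 : (d, 0) != (0, 0) :> {poly K} * {poly K} by rewrite xpair_eqE (negbTE d0).
have ab0 : (a, b) != (0, 0).
  by apply: contraNneq t0 => -[a0 b0]; rewrite E a0 b0 el0r rmorph0 mul0r.
have [n0 vn] := pole_el e0 xe we ab0; have [m0 vm] := pole_el e0 xe we d00.
move: tE; rewrite E -el0r pval_div // vn vm -mulrBr => {}E.
have : (e %| 1)%Z by apply/dvdzP; eexists; rewrite mulrC; apply/esym: E.
by rewrite dvdz1 => /eqP; lia.
Qed.

Lemma Qoo_el a b : (a, b) != (0, 0) -> pval Qoo (el a b) = - (degw a b)%:Z.
Proof.
by have [xE wE] := Qoo_values => /(pole_el (ltr01) xE wE) [_ ->]; rewrite mul1r.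
Qed.

(** * The coordinate ring K[x] + K[x] w and its localizations *)

Definition integral u := exists a b, u = el a b.

Lemma integral_ratfun a : integral (ratfun L a).
Proof. by exists a, 0; rewrite el0r. Qed.

Lemma integralM u v : integral u -> integral v -> integral (u * v).
Proof. by move=> [a [b ->]] [a' [b' ->]]; rewrite elM; do 2!eexists. Qed.

Lemma integralD u v : integral u -> integral v -> integral (u + v).
Proof. by move=> [a [b ->]] [a' [b' ->]]; rewrite elD; do 2!eexists. Qed.

Lemma integralX u k : integral u -> integral (u ^+ k).
Proof.
move=> hu; elim: k => [|k IH]; last by rewrite exprS; apply: integralM.
by rewrite expr0 -(rmorph1 (ratfun L)); apply: integral_ratfun.
Qed.

(* A prime [M] of [K[x] + K[x] w] over an irreducible [p], locally generated
   by [t]. *)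
Section LocalRing.
Variables (M : L -> Prop) (t : L) (p : {poly K}) (e : nat).
Definition off_prime u := integral u /\ ~ M u.
Local Notation U := off_prime.
Hypothesis p_irr : irreducible_poly p.
Hypothesis MM : forall u v, integral u -> M v -> M (u * v).
Hypothesis M_prime : forall u v, integral u -> integral v -> M (u * v) -> M u \/ M v.
Hypothesis M_ratfun : forall a, M (ratfun L a) <-> p %| a.
Hypothesis tM : M t.
Hypothesis tA : integral t.
Hypothesis t_gen : forall u, M u -> exists s (a : L), [/\ U s, integral a & s * u = t * a].
Hypothesis t_p : exists s s', [/\ U s, U s' & s * ratfun L p = s' * t ^+ e].

Lemma M0 : M 0.
Proof. by rewrite -(rmorph0 (ratfun L)); apply/M_ratfun; rewrite dvdp0. Qed.

Lemma U_neq0 u : U u -> u != 0.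
Proof. by case=> _ nM; apply/eqP => u0; apply: nM; rewrite u0; apply: M0. Qed.

Lemma U_mul u v : U u -> U v -> U (u * v).
Proof.
move=> [uA nu] [vA nv]; split; first exact: integralM.
by move/(M_prime uA vA) => [].
Qed.

Lemma U_ratfun a : U (ratfun L a) <-> ~~ (p %| a).
Proof.
split=> [[_ nM]|np]; first by apply/negP => /M_ratfun.
by split; [apply: integral_ratfun|move/M_ratfun; apply/negP].
Qed.

Lemma U1 : U 1.
Proof. by rewrite -(rmorph1 (ratfun L)); apply/U_ratfun/irredp_ndvd1. Qed.

Lemma U_expr u k : U u -> U (u ^+ k).
Proof.
by move=> hu; elim: k => [|k IH]; [apply: U1|rewrite exprS; apply: U_mul].
Qed.

Lemma t_neq0 : t != 0.
Proof.
apply/eqP => t0; have [|s [a [Us _ /eqP]]] := t_gen (u := ratfun L p).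
  by apply/M_ratfun.
rewrite t0 mul0r mulf_eq0 (negbTE (U_neq0 Us)) ratfun_eq0.
by rewrite (negbTE (irredp_neq0 p_irr)).
Qed.

(** Division of u by t terminates because u divides s t^k with s outside M: each division lowers k,
    and for k = 0 the element u itself is outside M. *)
Lemma local_order_aux k u (b : L) s : integral u -> integral b -> U s ->
  u * b = s * t ^+ k -> exists k' s1 s2, [/\ U s1, U s2 & s1 * u = s2 * t ^+ k'].
Proof.
elim: k u s => [|k IH] u s uA bA Us E.
all: have [Mu|nMu] := pselect (M u); last first.
1,3: by exists 0%N, 1, u; split; [apply: U1| |rewrite expr0 mulr1 mul1r].
  by case: Us => _ []; move: E; rewrite expr0 mulr1 => <-; rewrite mulrC; apply: MM.
have [s1 [a [Us1 aA E1]]] := t_gen Mu.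
have [||k' [s2 [s3 [Us2 Us3 E2]]]] := IH a (s1 * s) aA bA; first exact: U_mul.
  by apply: (mulfI t_neq0); transitivity (s1 * (u * b));
    [rewrite (mulrA s1 u) E1; ring|rewrite E exprS; ring].
exists k'.+1, (s2 * s1), s3; split=> //; first exact: U_mul.
by rewrite -mulrA E1 mulrCA E2 exprS; ring.
Qed.

(** The cofactor needed by [local_order_aux] is the conjugate of u. The norm of u is p^j r with r
    prime to p, and p is t^e up to elements outside M, which gives the exponent e j. *)
Lemma local_order_nat u : integral u -> u != 0 ->
  exists k s1 s2, [/\ U s1, U s2 & s1 * u = s2 * t ^+ k].
Proof.
move=> uA u0; have [a [b E]] := uA; have [s [s' [Us Us' Ep]]] := t_p.
have N0 : elnorm a b != 0.
  by apply/eqP => /elnorm_eq0 [a0 b0]; case/eqP: u0; rewrite E a0 b0 el0r rmorph0.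
have [j [r [Er nr]]] := irredp_multiplicity p_irr N0.
apply: (@local_order_aux (e * j) u (s ^+ j * el (a - b * h) (- b))
          (ratfun L r * s' ^+ j)) => //.
- by apply: integralM; [apply: integralX; case: Us|do 2!eexists].
- by apply: U_mul; [apply/U_ratfun|apply: U_expr].
- rewrite mulrCA E el_conj Er rmorphM rmorphXn mulrA -exprMn Ep exprMn exprM.
  by ring.
Qed.

Lemma local_order u : u != 0 ->
  exists (k : int) s1 s2, [/\ U s1, U s2 & s1 * u = s2 * t ^ k].
Proof.
move=> u0; have [a [b [d [d0 E]]]] := el_gen u.
have rd0 : ratfun L d != 0 by rewrite ratfun_eq0.
have en : u * ratfun L d = el a b by rewrite E mulfVK.
have [||k [s1 [s2 [Us1 Us2 E1]]]] := @local_order_nat (el a b).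
- by do 2!eexists.
- by rewrite -en mulf_neq0.
have [||j [s3 [s4 [Us3 Us4 E2]]]] := @local_order_nat (ratfun L d) => //.
  exact: integral_ratfun.
exists (k%:Z - j%:Z), (s4 * s1), (s3 * s2); split; try exact: U_mul.
rewrite expfzDr ?t_neq0 // -exprnN -exprnP.
apply: (mulIf (mulf_neq0 (expf_neq0 j t_neq0) rd0)).
have tj := expf_neq0 j t_neq0.
rewrite -{1}en in E1.
transitivity (s4 * t ^+ j * (s1 * (u * ratfun L d))); first by ring.
rewrite E1 -E2.
by transitivity (s3 * s2 * t ^+ k * ratfun L d * (t ^+ j / t ^+ j));
  [rewrite divff // ; ring|ring].
Qed.

(** If k < k', cross-multiplying gives s3 s2 = s1 s4 t^(k' - k), so a product of elements outside M
    would lie in M. *)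
Lemma local_order_ge u (k k' : int) s1 s2 s3 s4 : U s1 -> U s2 -> U s3 -> U s4 ->
  s1 * u = s2 * t ^ k -> s3 * u = s4 * t ^ k' -> k' <= k.
Proof.
move=> U1 U2 U3 U4 E E'; rewrite leNgt; apply/negP => lt.
have [n En] : exists n : nat, k' = k + n.+1%:Z by exists (`|k' - k|.-1)%N; lia.
have t0 := t_neq0; have tk0 : t ^ k != 0 by rewrite expfz_neq0.
have E3 : s3 * s2 = s1 * s4 * t ^+ n * t.
  apply: (mulIf tk0); transitivity (s1 * (s3 * u)); first by rewrite mulrCA E mulrA.
  by rewrite E' En expfzDr // -exprnP exprS; ring.
case: (U_mul U3 U2) => _; apply; rewrite E3; apply: MM => //.
by apply: integralM; [case: (U_mul U1 U4)|apply: integralX].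
Qed.

Lemma local_order_uniq u (k k' : int) s1 s2 s3 s4 : U s1 -> U s2 -> U s3 -> U s4 ->
  s1 * u = s2 * t ^ k -> s3 * u = s4 * t ^ k' -> k = k'.
Proof.
move=> U1 U2 U3 U4 E E'; apply/eqP; rewrite eq_le.
by rewrite (local_order_ge U3 U4 U1 U2 E' E) (local_order_ge U1 U2 U3 U4 E E').
Qed.

Lemma local_place : exists P, forall u (k : int) s1 s2,
  U s1 -> U s2 -> s1 * u = s2 * t ^ k -> pval P u = k.
Proof.
have t0 := t_neq0.
have [u|f fP] := @choice L int (fun u k => (u = 0 -> k = 0) /\ (u != 0 ->
    exists s1 s2, [/\ U s1, U s2 & s1 * u = s2 * t ^ k])).
  have [->|u0] := eqVneq u 0; first by exists 0; split=> // /eqP.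
  have [k [s1 [s2 H]]] := local_order u0; exists k.
  by split=> [/eqP|_]; [rewrite (negbTE u0)|exists s1, s2].
have fE u (k : int) s1 s2 : U s1 -> U s2 -> s1 * u = s2 * t ^ k -> f u = k.
  move=> Us1 Us2 E; have u0 : u != 0.
    apply/eqP => u0; move/esym/eqP: E; rewrite u0 mulr0 mulf_eq0.
    by rewrite (negbTE (U_neq0 Us2)) (negbTE (expfz_neq0 k t0)).
  by have [_ /(_ u0) [s3 [s4 [U3 U4 E']]]] := fP u; apply: local_order_uniq E' E.
have f0 : f 0 = 0 by case: (fP 0) => ->.
have fc (c : K) : c != 0 -> f (const L c) = 0.
  move=> c0; apply: (fE _ _ 1 (const L c)); first exact: U1.
    by apply/U_ratfun; rewrite -[c%:P]mulr1 mul_polyC dvdpZr // irredp_ndvd1.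
  by rewrite expr0z mulr1 mul1r.
have fM u v : u != 0 -> v != 0 -> f (u * v) = f u + f v.
  move=> u0 v0; have [_ /(_ u0) [s1 [s2 [U1 U2 E]]]] := fP u.
  have [_ /(_ v0) [s3 [s4 [U3 U4 E']]]] := fP v.
  apply: (fE _ _ (s1 * s3) (s2 * s4)); try exact: U_mul.
  by rewrite mulrACA E E' expfzDr // mulrACA.
(* After t^(f u) is factored out, the remaining z lies in the coordinate ring, where orders are
   natural numbers. *)
have fD_le u v : u != 0 -> v != 0 -> u + v != 0 -> f u <= f v -> f u <= f (u + v).
  move=> u0 v0 uv0 le; have [_ /(_ u0) [s1 [s2 [U1 U2 E]]]] := fP u.
  have [_ /(_ v0) [s3 [s4 [U3 U4 E']]]] := fP v.
  have [n En] : exists n : nat, f v = f u + n%:Z by exists `|f v - f u|%N; lia.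
  pose z := s3 * s2 + s1 * s4 * t ^+ n.
  have Ez : s1 * s3 * (u + v) = z * t ^ f u.
    transitivity (s3 * (s1 * u) + s1 * (s3 * v)); first by ring.
    by rewrite E E' En expfzDr // -exprnP /z; ring.
  have z0 : z != 0.
    apply: contraNneq (mulf_neq0 (U_neq0 (U_mul U1 U3)) uv0).
    by rewrite Ez => ->; rewrite mul0r.
  have [|m [s5 [s6 [U5 U6 E6]]]] := local_order_nat _ z0.
    apply: integralD; first by case: (U_mul U3 U2).
    by apply: integralM; [case: (U_mul U1 U4)|apply: integralX].
  rewrite (fE (u + v) (f u + m%:Z) (s5 * (s1 * s3)) s6) //; first lia.
    by apply: U_mul => //; apply: U_mul.
  by rewrite -mulrA Ez mulrA E6 expfzDr // -exprnP; ring.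
have fD u v : u != 0 -> v != 0 -> u + v != 0 -> Num.min (f u) (f v) <= f (u + v).
  move=> u0 v0 uv0; rewrite ge_min; have [le|/ltW le] := leP (f u) (f v).
    by rewrite fD_le.
  by rewrite (addrC u) (fD_le v u) ?orbT // addrC.
have ft : exists2 t, t != 0 & f t = 1.
  by exists t => //; apply: (fE _ _ 1 1); rewrite ?expr1z //; apply: U1.
by exists (Place f0 fc fM fD ft).
Qed.

Lemma local_place_proportional P :
  (forall u, M u -> vge P 1 u) -> (forall u, U u -> pval P u = 0) ->
  forall u (k : int) s1 s2,
    U s1 -> U s2 -> s1 * u = s2 * t ^ k -> pval P u = pval P t * k.
Proof.
move=> MP UP u k s1 s2 Us1 Us2 E.
have t0 := t_neq0; have tk0 : t ^ k != 0 by rewrite expfz_neq0.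
have u0 : u != 0.
  apply: contraNneq (mulf_neq0 (U_neq0 Us2) tk0).
  by rewrite -E => ->; rewrite mulr0.
have := pvalM P (U_neq0 Us1) u0.
by rewrite E (pvalM P (U_neq0 Us2) tk0) (UP s1) // (UP s2) // !add0r pvalXz.
Qed.

(** A place that is positive on M and zero outside M is v(t) times the order in t; normalization
    then leaves one possibility. *)
Lemma local_place_unique P P' :
  (forall u, M u -> vge P 1 u) -> (forall u, U u -> pval P u = 0) ->
  (forall u, M u -> vge P' 1 u) -> (forall u, U u -> pval P' u = 0) -> P = P'.
Proof.
move=> MP UP MP' UP'; have t0 := t_neq0.
have Pt : 0 < pval P t by have [/eqP|] := MP t tM; [rewrite (negbTE t0)|lia].
have Pt' : 0 < pval P' t by have [/eqP|] := MP' t tM; [rewrite (negbTE t0)|lia].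
apply: (place_eq_proportional Pt Pt') => u u0.
have [k [s1 [s2 [Us1 Us2 E]]]] := local_order u0.
exists k; split; first exact: (local_place_proportional MP UP Us1 Us2 E).
exact: (local_place_proportional MP' UP' Us1 Us2 E).
Qed.

Lemma local_placeP : exists P, [/\ forall u, M u -> vge P 1 u,
  forall u, U u -> pval P u = 0, pval P t = 1 &
  forall u, u != 0 -> exists s1 s2, [/\ U s1, U s2 & s1 * u = s2 * t ^ (pval P u)]].
Proof.
have [P PE] := local_place; have t0 := t_neq0.
have vt : pval P t = 1.
  by apply: (PE _ _ 1 1); rewrite ?expr1z //; apply: U1.
have vU u : U u -> pval P u = 0.
  by move=> Uu; apply: (PE _ _ 1 u); rewrite ?expr0z ?mulr1 ?mul1r //; apply: U1.
exists P; split=> // u.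
- move=> Mu; have [u0|u0] := eqVneq u 0; [by left|right].
  have [s [a [Us [a1 [a2 Ea]] E]]] := t_gen Mu.
  have a0 : a != 0.
    apply: contraNneq (mulf_neq0 (U_neq0 Us) u0).
    by rewrite E => ->; rewrite mulr0.
  have [|k [s1 [s2 [Us1 Us2 E']]]] := local_order_nat _ a0; first by do 2!eexists; exact: Ea.
  have := pvalM P (U_neq0 Us) u0; rewrite E pvalM // (vU s) // vt (PE a k s1 s2) //; lia.
- move=> u0; have [k [s1 [s2 [Us1 Us2 E]]]] := local_order u0.
  by exists s1, s2; split; rewrite // (PE u k s1 s2).
Qed.

End LocalRing.

(** * Places over an irreducible polynomial *)

Definition wpoly a : {poly K} := a ^+ 2 + h * a - g.

(* Smoothness of the affine curve: [w] ramified over a root [w0] modulo [p] of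
   its equation is a local uniformizer there. *)
Hypothesis smooth : forall p (w0 : {poly K}), irreducible_poly p -> p %| w0 *+ 2 + h ->
  p %| wpoly w0 -> ~~ (p ^+ 2 %| wpoly w0).

(** w is integral over K[x]: if it had a pole where x has none, w^2 would dominate h w and force a
    pole of g. *)
Lemma vge0_el P a b : vge P 0 x -> vge P 0 (el a b).
Proof.
move=> hx; have [xneg|x0] := ltP (pval P x) 0.
  case: hx => [x00|]; last by plia.
  by move: xneg; rewrite x00 pval0 ltxx.
suff hw : vge P 0 w.
  by apply: vgeD; [apply: vge0_ratfun|apply: vge0M => //; apply: vge0_ratfun].
have [w0|w0] := eqVneq w 0; [by left|right].
rewrite leNgt; apply/negP => wneg.
have w20 : w ^+ 2 != 0 by rewrite expf_neq0.
have [] := @pval_add_lt _ _ P (w ^+ 2) (ratfun L h * w) w20.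
  apply: (@vge_le _ _ _ (0 + pval P w)); first by rewrite pvalX //; plia.
  by apply: vgeM; [apply: vge0_ratfun|right].
rewrite w_eq pvalX // => g0 E; have [/eqP|] := vge0_ratfun g hx.
  by rewrite (negbTE g0).
by rewrite E; plia.
Qed.

Lemma vge1_dvdp P p a : irreducible_poly p -> vge P 0 x -> vge P 1 (ratfun L p) ->
  vge P 1 (ratfun L a) <-> p %| a.
Proof.
move=> irr x0 hp; split=> [ha|/dvdpP [q ->]]; last first.
  by rewrite rmorphM; apply: vge0M hp; apply: vge0_ratfun.
apply/negPn/negP => np; case: (@vge1_1 _ _ P).
have /Bezout_eq1_coprimepP [[u v] /= E] : coprimep p a.
  by rewrite irreducible_poly_coprime.
rewrite -(rmorph1 (ratfun L)) -E rmorphD !rmorphM.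
by apply: vgeD; apply: vge0M => //; apply: vge0_ratfun.
Qed.

Definition centered P p w0 :=
  [/\ vge P 0 x, vge P 1 (ratfun L p) & vge P 1 (w - ratfun L w0)].

Lemma centered_el P p w0 a b : irreducible_poly p -> centered P p w0 ->
  vge P 1 (el a b) <-> p %| a + b * w0.
Proof.
move=> irr [x0 hp hw]; rewrite -(vge1_dvdp _ irr x0 hp).
have hb : vge P 1 (ratfun L b * (w - ratfun L w0)).
  by apply: vge0M => //; apply: vge0_ratfun.
have -> : el a b = ratfun L (a + b * w0) + ratfun L b * (w - ratfun L w0).
  by rewrite /el rmorphD rmorphM; ring.
split=> H; last exact: vgeD.
by rewrite -[X in vge _ _ X](addrK (ratfun L b * (w - ratfun L w0))); apply: vgeB.
Qed.

Lemma pval_eq0 P u : vge P 0 u -> ~ vge P 1 u -> pval P u = 0.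
Proof.
case=> [->|u0] n1; first by case: n1; left.
by apply/eqP; rewrite eq_le u0 andbT leNgt; apply/negP => lt; apply: n1; right; plia.
Qed.

Lemma x_neq0 : x != 0.
Proof. by rewrite ratfun_eq0 polyX_eq0. Qed.

Lemma vge0_x P : vge P 0 x <-> P <> Qoo.
Proof.
rewrite vgeE ?x_neq0 //; split=> [x0 PQ|nQ]; first by move: x0; rewrite PQ leNgt Qoo_pole.
by rewrite leNgt; apply/negP => /pole_unique.
Qed.

Section PrimeAbove.
Variable p : {poly K}.
Hypothesis p_irr : irreducible_poly p.

(* The prime [(p, w - w0)]. *)
Definition point_ideal w0 u := exists a b, u = el a b /\ p %| a + b * w0.

Lemma point_idealE w0 a b : point_ideal w0 (el a b) <-> p %| a + b * w0.
Proof.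
by split=> [[a' [b' [/el_inj [-> ->]]]]|]; [|exists a, b].
Qed.

Lemma point_ideal_ratfun w0 a : point_ideal w0 (ratfun L a) <-> p %| a.
Proof. by rewrite -el0r point_idealE mul0r addr0. Qed.

Section Root.
Variable w0 : {poly K}.
Hypothesis w0_root : p %| wpoly w0.
Local Notation M := (point_ideal w0).

(** Substituting w0 for w modulo p is multiplicative, since w0 is a root of the equation modulo p.
    The ideal is the kernel of this map to the field K[X]/(p), hence prime. *)
Lemma point_ideal_el_mul a b a' b' :
  M (el a b * el a' b') <-> p %| (a + b * w0) * (a' + b' * w0).
Proof.
rewrite elM point_idealE.
have -> : a * a' + b * b' * g + (a * b' + b * a' - b * b' * h) * w0 =
  (a + b * w0) * (a' + b' * w0) - b * b' * wpoly w0 by rewrite /wpoly; ring.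
by rewrite dvdp_subl // dvdp_mull.
Qed.

Lemma point_idealM u v : integral u -> M v -> M (u * v).
Proof.
move=> [a [b ->]] [a' [b' [-> ab']]]; apply/point_ideal_el_mul.
by rewrite dvdp_mull.
Qed.

Lemma point_ideal_prime u v : integral u -> integral v -> M (u * v) -> M u \/ M v.
Proof.
move=> [a [b ->]] [a' [b' ->]] /point_ideal_el_mul /(irredp_dvdM p_irr) /orP.
by move=> [] H; [left|right]; apply/point_idealE.
Qed.

Lemma off_point a b : off_prime (M) (el a b) <-> ~~ (p %| a + b * w0).
Proof.
split=> [[_ nM]|nd]; first by apply/negP => /point_idealE.
by split; [do 2!eexists|move/point_idealE; apply/negP].
Qed.

Lemma w_subE : w - ratfun L w0 = el (- w0) 1.
Proof. by rewrite /el rmorphN rmorph1; ring. Qed.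

Lemma w_sub_conj : (w - ratfun L w0) * el (w0 + h) 1 = - ratfun L (wpoly w0).
Proof.
have -> : - ratfun L (wpoly w0) = el (- wpoly w0) 0 by rewrite el0r rmorphN.
by rewrite w_subE elM; congr el; rewrite /wpoly; ring.
Qed.

Lemma el_split a b : el a b = ratfun L (a + b * w0) + ratfun L b * (w - ratfun L w0).
Proof. by rewrite /el rmorphD rmorphM; ring. Qed.

Lemma point_place : exists P, [/\ centered P p w0,
  forall P', centered P' p w0 -> P' = P,
  if p %| w0 *+ 2 + h then
    pval P (ratfun L p) = 2 /\ pval P (w - ratfun L w0) = 1
  else pval P (ratfun L p) = 1 &
  forall u, u != 0 -> pval P u = 0 -> exists s s',
    [/\ off_prime M s, off_prime M s' & s * u = s']].
Proof.
have p0 := irredp_neq0 p_irr.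
have [c Ec] : exists c, wpoly w0 = p * c.
  by case/dvdpP: w0_root => c ->; exists c; rewrite mulrC.
have U_1 : off_prime M 1.
  by rewrite -el1; apply/off_point; rewrite mul0r addr0 irredp_ndvd1.
(* The cases differ only in the local generator t and the ramification index e: w - w0 and 2, or p
   and 1. *)
suff [t [e [tM tA t_gen t_p tE]]] : exists t e, [/\ M t, integral t,
    forall u, M u -> exists s (a : L), [/\ off_prime M s, integral a & s * u = t * a],
    exists s s', [/\ off_prime M s, off_prime M s' & s * ratfun L p = s' * t ^+ e] &
    forall P, (forall u, off_prime M u -> pval P u = 0) -> pval P t = 1 ->
      if p %| w0 *+ 2 + h then
        pval P (ratfun L p) = 2 /\ pval P (w - ratfun L w0) = 1
      else pval P (ratfun L p) = 1].
  have [P [MP UP Pt Pu]] := local_placeP p_irr point_idealM point_ideal_prime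
    (point_ideal_ratfun w0) tM tA t_gen t_p.
  have uniq P' : centered P' p w0 -> P' = P.
    move=> cP'; apply: (local_place_unique p_irr point_idealM point_ideal_prime
      (point_ideal_ratfun w0) tM t_gen t_p) => // u.
      by move=> [a [b [-> ab]]]; apply/(centered_el _ _ p_irr cP').
    move=> [[a [b ->]] nM]; apply: pval_eq0; first by apply: vge0_el; case: cP'.
    by move/(centered_el _ _ p_irr cP') => ab; apply/nM/point_idealE.
  exists P; split=> //; last 2 first.
  - exact: tE.
  - move=> u u0 vu; have [s [s' [Us Us' E]]] := Pu u u0.
    by exists s, s'; split=> //; rewrite E vu expr0z mulr1.
  split.
  - have xA : x = el 'X 0 by rewrite el0r.
    rewrite xA; have [d|/off_point/UP] := boolP (p %| 'X + 0 * w0); last by right; plia.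
    by apply: (@vge_le _ _ _ 1) => //; apply: MP; apply/point_idealE.
  - by apply: MP; apply/point_ideal_ratfun.
  - by apply: MP; rewrite w_subE; apply/point_idealE; rewrite mul1r addNr dvdp0.
have [ram|unr] := boolP (p %| w0 *+ 2 + h).
  (* [(w - w0) (w + w0 + h) = - p c] with [c] prime to [p] by smoothness, so
     locally [w - w0] divides [p]. *)
  have nc : ~~ (p %| c).
    have := smooth p_irr ram w0_root; apply: contra.
    by rewrite Ec expr2 dvdp_mul2l.
  have [d Ed] : exists d, w0 *+ 2 + h = p * d.
    by case/dvdpP: ram => d ->; exists d; rewrite mulrC.
  have Et : (w - ratfun L w0) ^+ 2 =
      - (ratfun L c + ratfun L d * (w - ratfun L w0)) * ratfun L p.
    have := w_sub_conj; rewrite Ec rmorphM.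
    have -> : el (w0 + h) 1 = (w - ratfun L w0) + ratfun L (w0 *+ 2 + h).
      by rewrite /el rmorph1 mulr2n !rmorphD; ring.
    rewrite Ed rmorphM => E; rewrite mulrDr in E.
    transitivity (- (ratfun L p * ratfun L c) -
      (w - ratfun L w0) * (ratfun L p * ratfun L d)); last by ring.
    by rewrite -E; ring.
  have Es : - (ratfun L c + ratfun L d * (w - ratfun L w0)) = el (- (c - d * w0)) (- d).
    by rewrite /el !rmorphN rmorphB rmorphM; ring.
  have Us : off_prime M (- (ratfun L c + ratfun L d * (w - ratfun L w0))).
    rewrite Es; apply/off_point.
    by have -> : - (c - d * w0) + - d * w0 = - c by [ring]; rewrite dvdpNr.
  exists (w - ratfun L w0), 2%N; split.
  - by rewrite w_subE; apply/point_idealE; rewrite mul1r addNr dvdp0.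
  - by rewrite w_subE; do 2!eexists.
  - move=> u [a [b [-> /dvdpP [q Eq]]]].
    (* Here a + b w = q p + b (w - w0). Multiplying by c turns p c into - (w - w0) (w + w0 + h),
       from which w - w0 factors out. *)
    exists (ratfun L c), (ratfun L (c * b) - ratfun L q * el (w0 + h) 1); split.
    + by rewrite -el0r; apply/off_point; rewrite mul0r addr0.
    + by rewrite -!el0r elM elB; do 2!eexists.
    + rewrite (el_split a b) Eq; have := w_sub_conj; rewrite Ec !rmorphM => E.
      transitivity (- (ratfun L q * - (ratfun L p * ratfun L c)) +
        ratfun L c * (ratfun L b * (w - ratfun L w0))); first by ring.
      by rewrite -E; ring.
  - exists (- (ratfun L c + ratfun L d * (w - ratfun L w0))), 1.
    by rewrite mul1r Et.
  - move=> P UP Pt; split=> //; have rp0 : ratfun L p != 0 by rewrite ratfun_eq0.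
    have s0 : - (ratfun L c + ratfun L d * (w - ratfun L w0)) != 0.
      by apply/eqP => s0; case: Us => _; apply; rewrite s0 -(rmorph0 (ratfun L));
        apply/point_ideal_ratfun; rewrite dvdp0.
    have t0 : w - ratfun L w0 != 0.
      by apply/eqP => t0; move: Pt; rewrite t0 pval0.
    have := congr1 (pval P) Et; rewrite pvalX // (pvalM P s0 rp0) (UP _ Us) Pt; lia.
(* Here the conjugate factor [w + w0 + h] is a unit, so locally [p] divides
   [w - w0]. *)
have Us : off_prime M (el (w0 + h) 1).
  by apply/off_point; have -> : w0 + h + 1 * w0 = w0 *+ 2 + h by rewrite mulr2n; ring.
exists (ratfun L p), 1%N; split=> //.
- exact/point_ideal_ratfun.
- exact: integral_ratfun.
- move=> u [a [b [-> /dvdpP [q Eq]]]].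
  (* Multiplying a + b w = q p + b (w - w0) by the conjugate factor turns (w - w0) (w + w0 + h) into
     - p c. *)
  exists (el (w0 + h) 1), (ratfun L q * el (w0 + h) 1 - ratfun L (b * c)); split=> //.
    by rewrite -!el0r elM elB; do 2!eexists.
  rewrite (el_split a b) Eq; have := w_sub_conj; rewrite Ec !rmorphM => E.
  transitivity (ratfun L p * (ratfun L q * el (w0 + h) 1) +
    ratfun L b * ((w - ratfun L w0) * el (w0 + h) 1)); first by ring.
  by rewrite E; ring.
- by exists 1, 1.
Qed.

End Root.

(** Without a root modulo p, the element p generates a prime ideal and is its own local generator.
    Primality comes from the norm: if p divides the norm of a + b w but not b, then - a / b is a
    root modulo p. *)
Lemma inert_place : (forall w0, ~~ (p %| wpoly w0)) ->
  exists P, [/\ vge P 0 x, pval P (ratfun L p) = 1 &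
    forall a b, vge P 1 (el a b) -> p %| a /\ p %| b].
Proof.
move=> nroot; pose M u := exists a b, [/\ u = el a b, p %| a & p %| b].
have ME a b : M (el a b) <-> p %| a /\ p %| b.
  by split=> [[a' [b' [/el_inj [-> ->]]]]|[]]; [|exists a, b].
have norm_dvd a b : p %| elnorm a b -> p %| a /\ p %| b.
  move=> pN; have [pb|npb] := boolP (p %| b).
    split=> //; have : p %| a ^+ 2.
      have -> : a ^+ 2 = elnorm a b + b * (a * h + b * g) by rewrite /elnorm; ring.
      by rewrite dvdp_add // dvdp_mulr.
    by rewrite expr2 => /(irredp_dvdM p_irr) /orP[].
  have /Bezout_eq1_coprimepP [[q c] /= E] : coprimep p b.
    by rewrite irreducible_poly_coprime.
  (* The Bezout coefficient c inverts b modulo p, so - a c stands for - a / b. *)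
  have := nroot (- (a * c)); rewrite /wpoly.
  have Eb : c * b = 1 - q * p by rewrite -E; ring.
  have -> : (- (a * c)) ^+ 2 + h * - (a * c) - g = c ^+ 2 * elnorm a b -
      p * (q * (a * c * h + (2 - q * p) * g)).
    have -> : c ^+ 2 * elnorm a b = (a * c) ^+ 2 - a * c * (c * b) * h - (c * b) ^+ 2 * g.
      by rewrite /elnorm; ring.
    by rewrite Eb; ring.
  by rewrite (dvdp_sub (dvdp_mull _ pN) (dvdp_mulIl _ _)).
have MM u v : integral u -> M v -> M (u * v).
  move=> [a [b ->]] [a' [b' [-> pa' pb']]]; rewrite elM; apply/ME; split.
    exact: dvdp_add (dvdp_mull a pa') (dvdp_mulr g (dvdp_mull b pb')).
  exact: dvdp_sub (dvdp_add (dvdp_mull a pb') (dvdp_mull b pa'))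
    (dvdp_mulr h (dvdp_mull b pb')).
have Mr a : M (ratfun L a) <-> p %| a.
  by rewrite -el0r ME; split=> [[]|] //; rewrite dvdp0.
have M_prime u v : integral u -> integral v -> M (u * v) -> M u \/ M v.
  move=> [a [b ->]] [a' [b' ->]] Muv.
  have : M (ratfun L (elnorm a b * elnorm a' b')).
    rewrite ratfunM -!el_conj.
    rewrite (_ : _ * _ = (el (a - b * h) (- b) * el (a' - b' * h) (- b')) *
      (el a b * el a' b')); last by ring.
    by apply: MM => //; apply: integralM; do 2!eexists.
  move/Mr/(irredp_dvdM p_irr)/orP => [] /norm_dvd ?; [left|right]; exact/ME.
have U_1 : off_prime M 1.
  by rewrite -(rmorph1 (ratfun L)); split;
    [apply: integral_ratfun|move/Mr; apply/negP/irredp_ndvd1].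
have t_gen u : M u -> exists s (a : L), [/\ off_prime M s, integral a & s * u = ratfun L p * a].
  move=> [a [b [-> /dvdpP [a' ->] /dvdpP [b' ->]]]]; exists 1, (el a' b'); split=> //.
    by do 2!eexists.
  by rewrite mul1r /el !rmorphM; ring.
have t_p : exists s s', [/\ off_prime M s, off_prime M s' &
  s * ratfun L p = s' * ratfun L p ^+ 1] by exists 1, 1.
have tM : M (ratfun L p) by apply/Mr.
have [P [MP UP Pt _]] := local_placeP p_irr MM M_prime Mr tM
  (integral_ratfun p) t_gen t_p.
exists P; split=> //.
  rewrite -[x]el0r; have [/MP|nM] := pselect (M (el 'X 0)); first exact: vge_le.
  by right; rewrite UP //; split=> //; do 2!eexists.
move=> a b ab; apply/ME; apply: contrapT => nM.
have /UP E : off_prime M (el a b) by split=> //; do 2!eexists.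
case: ab; last by rewrite E.
by move=> e0; apply: nM; rewrite e0 -(rmorph0 (ratfun L)); apply/Mr; rewrite dvdp0.
Qed.

(** This is where smoothness gives integral closedness, one prime p at a time. The cases are those
    of the splitting of p: inert, ramified, or split into two conjugate places. *)
Lemma dvdp_of_vge0 a b : (forall P, P <> Qoo -> vge P 0 (el a b / ratfun L p)) ->
  p %| a /\ p %| b.
Proof.
move=> H; have rp0 : ratfun L p != 0 by rewrite ratfun_eq0 irredp_neq0.
have vp P n : vge P 0 x -> n <= pval P (ratfun L p) -> vge P n (el a b).
  move=> /vge0_x nQ vn; rewrite -(divfK rp0 (el a b)).
  by apply: vge0M (H _ nQ) _; right.
have [[w0 root0]|nroot] := pselect (exists w0, p %| wpoly w0); last first.
  have [|P [Px vP]] := inert_place; last by apply; apply: vp; rewrite // vP.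
  by move=> w0; apply/negP => root0; apply: nroot; exists w0.
have [P [cP _ + _]] := point_place root0; have [Px _ hw] := cP.
have conclude : p %| a + b * w0 -> p %| b -> p %| a /\ p %| b.
  by move=> hab hb; split=> //; rewrite -(dvdp_addl _ (dvdp_mulr w0 hb)).
(* Ramified case: p has value 2, so b (w - w0) has value at least 2 while w - w0 has value 1; hence
   p divides b. *)
have [ram [P2 Pw]|unr P1] := boolP (p %| w0 *+ 2 + h).
  have v2 : vge P 2 (el a b) by apply: vp; rewrite // P2.
  have hab : p %| a + b * w0 by apply/(centered_el _ _ p_irr cP); apply: vge_le v2.
  apply: conclude => //; apply/(vge1_dvdp _ p_irr Px); first by right; rewrite P2.
  have [b0|b0] := eqVneq (ratfun L b) 0; [by left|right].
  have wn : w - ratfun L w0 != 0 by apply/eqP => e; move: Pw; rewrite e pval0.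
  have : vge P 2 (ratfun L b * (w - ratfun L w0)).
    have -> : ratfun L b * (w - ratfun L w0) = el a b - ratfun L (a + b * w0).
      by rewrite (el_split w0); ring.
    apply: vgeB => //; case/dvdpP: hab => q ->; rewrite ratfunM.
    by apply: vge0M; [apply: vge0_ratfun|right; rewrite P2].
  by move/vgeE; rewrite mulf_neq0 // pvalM // Pw => /(_ isT); plia.
(* Split case: the conjugate root gives a second place. The congruences at the two places differ by
   b (2 w0 + h), whose second factor is prime to p. *)
have root1 : p %| wpoly (- h - w0).
  by have -> : wpoly (- h - w0) = wpoly w0 by rewrite /wpoly; ring.
have [P' [cP' _ + _]] := point_place root1; have [Px' _ _] := cP'.
have -> : (- h - w0) *+ 2 + h = - (w0 *+ 2 + h) by rewrite !mulr2n; ring.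
rewrite dvdpNr (negbTE unr) => P1'.
have h0 : p %| a + b * w0.
  by apply/(centered_el _ _ p_irr cP); apply: vp; rewrite // P1.
have h1 : p %| a + b * (- h - w0).
  by apply/(centered_el _ _ p_irr cP'); apply: vp; rewrite // P1'.
apply: conclude => //; have := dvdp_sub h0 h1.
have -> : a + b * w0 - (a + b * (- h - w0)) = b * (w0 *+ 2 + h).
  by rewrite mulr2n; ring.
by move/(irredp_dvdM p_irr); rewrite (negbTE unr) orbF.
Qed.

End PrimeAbove.

(** Irreducible factors of the denominator are removed one at a time until it is constant. *)
Lemma integral_of_vge0 u : (forall P, P <> Qoo -> vge P 0 u) -> integral u.
Proof.
have [a [b [d [d0 ->]]]] := el_gen u.
have [n] := ubnP (size d); elim: n a b d d0 => // n IH a b d d0 lt H.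
have sd : (0 < size d)%N by rewrite size_poly_gt0.
have [d1|d1] := leqP (size d) 1.
  have /size_poly1P [c c0 Ec] : size d == 1%N by rewrite eqn_leq d1.
  have rd0 : ratfun L d != 0 by rewrite ratfun_eq0.
  have cd : ratfun L (c^-1)%:P * ratfun L d = 1.
    by rewrite -ratfunM Ec -polyCM mulVf // rmorph1.
  exists (c^-1 *: a), (c^-1 *: b); apply: (mulIf rd0); rewrite divfK //.
  rewrite /el -!mul_polyC !ratfunM.
  transitivity (ratfun L (c^-1)%:P * ratfun L d * el a b); first by rewrite cd mul1r.
  by rewrite /el; ring.
have [p irr pd] := irredp_factor d1; have p0 := irredp_neq0 irr.
case/dvdpP: pd => d' Ed.
have d'0 : d' != 0 by apply: contraNneq d0 => e; rewrite Ed e mul0r.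
have [rp0 rd'0] : ratfun L p != 0 /\ ratfun L d' != 0 by rewrite !ratfun_eq0.
have [|/dvdpP [a' Ea] /dvdpP [b' Eb]] := @dvdp_of_vge0 p irr a b.
  move=> P nQ; have -> : el a b / ratfun L p = ratfun L d' * (el a b / ratfun L d).
    by rewrite Ed ratfunM; field; rewrite rp0 rd'0.
  by apply: vge0M (H _ nQ); apply: vge0_ratfun; apply/vge0_x.
have E : el a b / ratfun L d = el a' b' / ratfun L d'.
  by rewrite /el Ea Eb Ed !ratfunM; field; rewrite rp0 rd'0.
rewrite E; apply: IH => // [|P nQ]; last by rewrite -E; apply: H.
have := size_mul d'0 p0; rewrite -Ed; have [p1 _] := irr.
by move: lt p1 sd; move: (size p) (size d) (size d') => i j k; lia.
Qed.

(** * Rational points, lines and the group law *)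

Definition on_curve (x0 w0 : K) := w0 ^+ 2 + h.[x0] * w0 - g.[x0] = 0.

Definition at_point P (x0 w0 : K) := centered P ('X - x0%:P) w0%:P.

Lemma ratfun_XsubC (x0 : K) : ratfun L ('X - x0%:P) = x - const L x0.
Proof. by rewrite rmorphB. Qed.

Lemma at_pointE P (x0 w0 : K) :
  at_point P x0 w0 <-> vge P 1 (x - const L x0) /\ vge P 1 (w - const L w0).
Proof.
rewrite /at_point /centered ratfun_XsubC; split=> [[]|[hx hw]] //; split=> //.
rewrite -(subrK (const L x0) x); apply: vgeD (vge_const P x0).
exact: vge_le hx.
Qed.

Lemma at_point_el P (x0 w0 : K) a b : at_point P x0 w0 ->
  vge P 1 (el a b) <-> a.[x0] + b.[x0] * w0 = 0.
Proof.
move=> hP; rewrite (centered_el _ _ (irredp_XsubC x0) hP) dvdp_XsubCl /root.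
by rewrite hornerD hornerM hornerC; split=> [/eqP|->].
Qed.

Lemma at_point_ratfun P (x0 w0 : K) a : at_point P x0 w0 ->
  vge P 1 (ratfun L a) <-> a.[x0] = 0.
Proof. by move=> hP; rewrite -el0r (at_point_el _ _ hP) horner0 mul0r addr0. Qed.

Lemma at_point_neq_infty P (x0 w0 : K) : at_point P x0 w0 -> P <> Qoo.
Proof. by case=> /vge0_x. Qed.

Lemma wpoly_horner (l : {poly K}) (x0 : K) :
  (wpoly l).[x0] = l.[x0] ^+ 2 + h.[x0] * l.[x0] - g.[x0].
Proof. by rewrite /wpoly !hornerE. Qed.

Lemma at_point_on_curve P (x0 w0 : K) : at_point P x0 w0 -> on_curve x0 w0.
Proof.
move=> hP; have [x0P _ hw] := hP.
have : vge P 1 (ratfun L (wpoly w0%:P)).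
  apply/vgeN; rewrite -w_sub_conj mulrC; apply: vge0M hw; exact: vge0_el.
by rewrite (at_point_ratfun _ hP) wpoly_horner hornerC.
Qed.

Lemma on_curve_dvdp (x0 w0 : K) : on_curve x0 w0 -> 'X - x0%:P %| wpoly w0%:P.
Proof. by move=> E; rewrite dvdp_XsubCl /root wpoly_horner hornerC; apply/eqP. Qed.

Lemma ramified_dvdp (x0 w0 : K) :
  ('X - x0%:P %| w0%:P *+ 2 + h) = (w0 *+ 2 + h.[x0] == 0).
Proof. by rewrite dvdp_XsubCl /root hornerD hornerMn hornerC. Qed.

Lemma at_point_unique P P' (x0 w0 : K) : at_point P x0 w0 -> at_point P' x0 w0 -> P = P'.
Proof.
move=> hP hP'; have root0 := on_curve_dvdp (at_point_on_curve hP).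
have [P0 [_ U _ _]] := point_place (irredp_XsubC x0) root0.
by rewrite (U _ hP) (U _ hP').
Qed.

Lemma point_exists (x0 w0 : K) : on_curve x0 w0 ->
  exists2 P, rational P & at_point P x0 w0.
Proof.
move=> /on_curve_dvdp root0; have irr := irredp_XsubC x0.
have [P [hP _ _ Pu]] := point_place irr root0; exists P => // u [->|uge0].
  by exists 0; left; rewrite /const polyC0 rmorph0 subr0.
have [u0|nu] := pselect (vge P 1 u).
  by exists 0; rewrite /const polyC0 rmorph0 subr0; case: u0; [left|right].
have vu := pval_eq0 (or_intror uge0) nu.
have u0 : u != 0 by apply/eqP => u0; apply: nu; left.
have [s [s' [[[a [b Es]] Us] [[a' [b' Es']] Us'] E]]] := Pu u u0 vu.
pose ev a b := a.[x0] + b.[x0] * w0.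
have ns : ev a b != 0.
  apply/eqP => /(at_point_el _ _ hP)/(centered_el _ _ irr hP) d; apply: Us.
  by rewrite Es; apply/point_idealE.
have s0 : s != 0.
  by apply: contra_notN Us => /eqP ->; rewrite -(rmorph0 (ratfun L));
    apply/(point_ideal_ratfun _ _ 0); rewrite dvdp0.
(* The residue of u = s' / s is found by evaluating both elements at the point (x0, w0). *)
pose c := ev a' b' / ev a b; exists c.
have : vge P 1 (s * (u - const L c)).
  have -> : s * (u - const L c) = el (a' - c%:P * a) (b' - c%:P * b).
    by rewrite -elB !elZ -Es' -Es -E /const; ring.
  apply/(at_point_el _ _ hP); rewrite !hornerE.
  transitivity (ev a' b' - c * ev a b); first by rewrite /ev; ring.
  by rewrite /c divfK // subrr.
have vs : pval P s = 0.
  apply: pval_eq0; first by rewrite Es; apply: vge0_el; case: hP.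
  by rewrite Es => /(at_point_el _ _ hP) /eqP; apply/negP.
have [->|uc0] := eqVneq (u - const L c) 0; first by left.
by rewrite vgeE ?mulf_neq0 // pvalM // vs add0r => ?; right; plia.
Qed.

Lemma pval_x_sub P (x0 w0 : K) : at_point P x0 w0 ->
  pval P (x - const L x0) = (if w0 *+ 2 + h.[x0] == 0 then 2 else 1) /\
  (w0 *+ 2 + h.[x0] = 0 -> pval P (w - const L w0) = 1).
Proof.
move=> hP; have root0 := on_curve_dvdp (at_point_on_curve hP).
have [P0 [_ U + _]] := point_place (irredp_XsubC x0) root0.
rewrite -(U _ hP) ratfun_XsubC ramified_dvdp.
by have [e [-> ->]|/eqP ne ->] := eqVneq.
Qed.

Lemma x_sub_neq0 (c : K) : x - const L c != 0.
Proof. by rewrite -ratfun_XsubC ratfun_eq0 polyXsubC_eq0. Qed.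

Lemma pval_x_sub_other P (x0 w0 c : K) : at_point P x0 w0 -> c != x0 ->
  pval P (x - const L c) = 0.
Proof.
move=> hP ne; rewrite -ratfun_XsubC; apply: pval_eq0.
  by apply: vge0_ratfun; case: hP.
by rewrite (at_point_ratfun _ hP) hornerXsubC => /eqP; rewrite subr_eq0 eq_sym (negbTE ne).
Qed.

Lemma at_point_value P (x0 w0 : K) : at_point P x0 w0 ->
  value_at P x = x0 /\ value_at P w = w0.
Proof.
move=> /at_pointE [hx hw].
have value u (c : K) : vge P 1 (u - const L c) -> value_at P u = c.
  move=> hc; apply: xget_unique; first by case: hc; [left|right].
  move=> c' hc'; have {}hc' : vge P 1 (u - const L c') by case: hc'; [left|right].
  apply/eqP; rewrite -subr_eq0; apply/eqP/(@vge1_const _ L P).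
  rewrite /const polyCB rmorphB.
  have -> : ratfun L c'%:P - ratfun L c%:P = (u - const L c) - (u - const L c').
    by rewrite /const; ring.
  exact: vgeB.
by split; apply: value.
Qed.

Lemma at_point_inj P (x0 w0 x1 w1 : K) :
  at_point P x0 w0 -> at_point P x1 w1 -> x0 = x1 /\ w0 = w1.
Proof. by move=> /at_point_value [<- <-] /at_point_value [<- <-]. Qed.

Lemma rational_at_point P : rational P -> P <> Qoo ->
  at_point P (value_at P x) (value_at P w).
Proof.
move=> ratP /vge0_x x0.
have value u : vge P 0 u -> vge P 1 (u - const L (value_at P u)).
  move=> u0; have [|c hc] := ratP u; first by case: u0; [left|right].
  have : in_maximal_ideal P (u - const L (value_at P u)).
    exact: (@xgetI _ 0 (mkset (fun c => in_maximal_ideal P (u - const L c))) c hc).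
  by case; [left|right].
apply/at_pointE; split; apply: value => //.
have -> : w = el 0 1 by rewrite /el rmorph0 rmorph1 add0r mul1r.
exact: vge0_el.
Qed.

Lemma at_point_conj P (x0 w0 : K) : on_curve x0 w0 ->
  vge P 1 (x - const L x0) -> at_point P x0 w0 \/ at_point P x0 (- h.[x0] - w0).
Proof.
move=> E hx; have x0P : vge P 0 x.
  rewrite -(subrK (const L x0) x); apply: vgeD (vge_const P x0); exact: vge_le hx.
have [hw|nw] := pselect (vge P 1 (w - const L w0)); first by left; apply/at_pointE.
right; apply/at_pointE; split=> //; rewrite -ratfun_XsubC in hx.
have irr := irredp_XsubC x0.
have hp a : vge P 1 (ratfun L a) <-> a.[x0] = 0.
  by rewrite (vge1_dvdp _ irr x0P hx) dvdp_XsubCl /root; split=> [/eqP|->].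
have -> : w - const L (- h.[x0] - w0) = el (w0%:P + h) 1 - ratfun L (h - h.[x0]%:P).
  by rewrite /el /const !(polyCB, polyCN) !(rmorphB, rmorphD, rmorphN) rmorph1; ring.
apply: vgeB; last by apply/hp; rewrite !hornerE subrr.
apply: contrapT => nw'.
have wE : w - const L w0 = el (- w0%:P) 1 by rewrite -w_subE.
have [v1 v2] : pval P (w - const L w0) = 0 /\ pval P (el (w0%:P + h) 1) = 0.
  by split; apply: pval_eq0 => //; rewrite ?wE; apply: vge0_el.
have [n1 n2] : w - const L w0 != 0 /\ el (w0%:P + h) 1 != 0.
  by split; apply/eqP => e0; [apply: nw|apply: nw']; rewrite e0; left.
have : vge P 1 ((w - const L w0) * el (w0%:P + h) 1).
  by rewrite w_sub_conj; apply/vgeN/hp; rewrite wpoly_horner hornerC.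
by rewrite vgeE ?mulf_neq0 // pvalM // v1 v2.
Qed.

Lemma at_point_eq P P' (x0 w0 x1 w1 : K) : at_point P x0 w0 -> at_point P' x1 w1 ->
  (P == P') = (x0 == x1) && (w0 == w1).
Proof.
move=> hP hP'; apply/eqP/andP => [E|[/eqP ex /eqP ew]].
  by move: hP; rewrite E => /at_point_inj/(_ hP') [-> ->].
by apply: at_point_unique hP _; rewrite ex ew.
Qed.

(** * Divisors of vertical lines and of chords *)

Lemma conj_eq (x0 w0 : K) : (- h.[x0] - w0 == w0) = (w0 *+ 2 + h.[x0] == 0).
Proof.
rewrite -[in RHS]oppr_eq0 -[in LHS]subr_eq0; congr (_ == _); rewrite mulr2n; ring.
Qed.

Lemma div_x_sub P P' (x0 w0 : K) (v : place L) :
  at_point P x0 w0 -> at_point P' x0 (- h.[x0] - w0) ->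
  pval v (x - const L x0) = (P == v)%:R + (P' == v)%:R - (Qoo == v)%:R *+ 2.
Proof.
move=> hP hP'; have [<-|nQ] := eqVneq Qoo v.
  have /negbTE -> : P != Qoo by apply/eqP/(at_point_neq_infty hP).
  have /negbTE -> : P' != Qoo by apply/eqP/(at_point_neq_infty hP').
  rewrite -ratfun_XsubC -el0r Qoo_el; last by rewrite xpair_eqE polyXsubC_eq0.
  by rewrite /degw eqxx size_XsubC.
have x0v : vge v 0 x by apply/vge0_x => e; rewrite e eqxx in nQ.
rewrite mul0rn subr0.
have [hx|nx] := pselect (vge v 1 (x - const L x0)); last first.
  have -> : pval v (x - const L x0) = 0.
    by apply: pval_eq0 => //; rewrite -ratfun_XsubC; apply: vge0_ratfun.
  have /negbTE -> : P != v by apply/eqP => e; apply: nx; rewrite -e; case/at_pointE: hP.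
  by have /negbTE -> : P' != v
    by apply/eqP => e; apply: nx; rewrite -e; case/at_pointE: hP'.
have [hv|hv] := at_point_conj (at_point_on_curve hP) hx; have [-> _] := pval_x_sub hv.
  rewrite (at_point_eq hP hv) (at_point_eq hP' hv) !eqxx /= conj_eq.
  by case: eqP.
rewrite (at_point_eq hP hv) (at_point_eq hP' hv) !eqxx /= (eq_sym w0) conj_eq.
have -> : (- h.[x0] - w0) *+ 2 + h.[x0] = - (w0 *+ 2 + h.[x0]) by rewrite !mulr2n; ring.
by rewrite oppr_eq0; case: eqP.
Qed.

Lemma w_sub_neq0 (l : {poly K}) : w - ratfun L l != 0.
Proof.
by rewrite w_subE; apply/eqP => /el_eq0 [_ /eqP]; rewrite oner_eq0.
Qed.

Lemma pval_line_infty (l : {poly K}) : (size l <= 2)%N -> pval Qoo (w - ratfun L l) = -3.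
Proof.
move=> sl; rewrite w_subE Qoo_el ?xpair_eqE ?oner_eq0 ?andbF //.
rewrite /degw oner_eq0 size_polyN size_poly1.
by case: (size l) sl => [|[|[|]]].
Qed.

(** Up to sign, w - l times w + l + h is k times the product of the x - xi. What remains is to split
    this valuation between the two factors. *)
Lemma div_line (l : {poly K}) (k x1 x2 x3 : K) P1 P2 P3 (v : place L) : (size l <= 2)%N -> k != 0 ->
  wpoly l = k%:P * (('X - x1%:P) * ('X - x2%:P) * ('X - x3%:P)) ->
  at_point P1 x1 l.[x1] -> at_point P2 x2 l.[x2] -> at_point P3 x3 l.[x3] ->
  pval v (w - ratfun L l) =
    (P1 == v)%:R + (P2 == v)%:R + (P3 == v)%:R - (Qoo == v)%:R *+ 3.
Proof.
move=> sl k0 E hP1 hP2 hP3; have wl0 := w_sub_neq0 l.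
have [<-|nQ] := eqVneq Qoo v.
  have /negbTE -> : P1 != Qoo by apply/eqP/(at_point_neq_infty hP1).
  have /negbTE -> : P2 != Qoo by apply/eqP/(at_point_neq_infty hP2).
  have /negbTE -> : P3 != Qoo by apply/eqP/(at_point_neq_infty hP3).
  by rewrite pval_line_infty.
rewrite mul0rn subr0; have x0v : vge v 0 x by apply/vge0_x => e; rewrite e eqxx in nQ.
have wA : vge v 0 (w - ratfun L l) by rewrite w_subE; apply: vge0_el.
have cA : vge v 0 (el (l + h) 1) by apply: vge0_el.
have [hl|nl] := pselect (vge v 1 (w - ratfun L l)); last first.
  have on P (c : K) : at_point P c l.[c] -> (P == v) = false.
    move=> hP; apply/negP => /eqP e; apply: nl; rewrite -e w_subE.
    by apply/(at_point_el _ _ hP); rewrite !hornerE addNr.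
  by rewrite (on P1 x1) // (on P2 x2) // (on P3 x3) // pval_eq0.
have c0 : el (l + h) 1 != 0.
  by apply/eqP => /el_eq0 [_ /eqP]; rewrite oner_eq0.
have sub0 := x_sub_neq0.
have norm : (w - ratfun L l) * el (l + h) 1 =
    - (const L k * ((x - const L x1) * (x - const L x2) * (x - const L x3))).
  by rewrite w_sub_conj E !ratfunM !ratfun_XsubC.
have vnorm : pval v (w - ratfun L l) + pval v (el (l + h) 1) =
    pval v (x - const L x1) + pval v (x - const L x2) + pval v (x - const L x3).
  have kL0 : const L k != 0 by rewrite const_eq0.
  have s12 := mulf_neq0 (sub0 x1) (sub0 x2); have s123 := mulf_neq0 s12 (sub0 x3).
  rewrite -pvalM // norm pvalN (pvalM v kL0 s123) (pvalM v s12 (sub0 x3)).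
  by rewrite (pvalM v (sub0 x1) (sub0 x2)) (pval_const v k) add0r.
have at_c (c : K) : vge v 1 (x - const L c) -> at_point v c l.[c].
  move=> hx; apply/at_pointE; split=> //.
  have -> : w - const L l.[c] = (w - ratfun L l) + ratfun L (l - l.[c]%:P).
    by rewrite rmorphB /const; ring.
  apply: vgeD => //; rewrite -ratfun_XsubC in hx.
  by apply/(vge1_dvdp _ (irredp_XsubC c) x0v hx); rewrite dvdp_XsubCl /root !hornerE subrr.
have [c hv] : exists c, at_point v c l.[c].
  apply: contrapT => nc.
  have z (c : K) : pval v (x - const L c) = 0.
    apply: pval_eq0; last by move/at_c => ?; apply: nc; exists c.
    by rewrite -ratfun_XsubC; apply: vge0_ratfun.
  have : 1 <= pval v (w - ratfun L l) by apply/vgeE.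
  have : 0 <= pval v (el (l + h) 1) by apply/vgeE.
  by move: vnorm; rewrite !z; plia.
have eqv P (d : K) : at_point P d l.[d] -> (P == v) = (d == c).
  by move=> hP; rewrite (at_point_eq hP hv); case: eqVneq => // ->; rewrite eqxx.
rewrite (eqv P1 x1) // (eqv P2 x2) // (eqv P3 x3) //.
have [vx vw] := pval_x_sub hv; have vother := pval_x_sub_other hv.
(* At an unramified point the conjugate factor is a unit, and each x - xi with xi = c contributes
   1. *)
have [ram|unr] := eqVneq (l.[c] *+ 2 + h.[c]) 0; last first.
  rewrite (negbTE unr) in vx.
  have vd (d : K) : pval v (x - const L d) = (d == c)%:R.
    by have [->|/vother] := eqVneq d c.
  rewrite -!vd -vnorm (@pval_eq0 v (el (l + h) 1)) ?addr0 //.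
  rewrite (at_point_el _ _ hv) !hornerE => e; case/eqP: unr.
  by rewrite -e mulr2n; ring.
rewrite ram eqxx in vx.
have vd (d : K) : pval v (x - const L d) = (d == c)%:R *+ 2.
  by have [->|/vother] := eqVneq d c.
have wc0 : w - const L l.[c] != 0 by apply: w_sub_neq0.
have {}vw := vw ram.
have v1 (a : {poly K}) : a.[c] = 0 -> pval v ((w - const L l.[c]) + ratfun L a) = 1.
  move=> ac; rewrite -vw; have [] // := @pval_add_lt _ _ v (w - const L l.[c]) (ratfun L a) wc0.
  rewrite vw; have /dvdpP [q ->] : 'X - c%:P %| a by rewrite dvdp_XsubCl /root ac.
  by rewrite ratfunM ratfun_XsubC; apply: vge0M; [apply: vge0_ratfun|right; rewrite vx].
have e1 : w - ratfun L l = (w - const L l.[c]) + ratfun L (l.[c]%:P - l).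
  by rewrite rmorphB /const; ring.
have e2 : el (l + h) 1 = (w - const L l.[c]) + ratfun L (l + h + l.[c]%:P).
  by rewrite /el !rmorphD rmorph1 /const; ring.
have w1 : pval v (w - ratfun L l) = 1 by rewrite e1 v1 // !hornerE subrr.
have w2 : pval v (el (l + h) 1) = 1.
  by rewrite e2 v1 // !hornerE -ram mulr2n; ring.
(* At a ramified point both factors have value 1, and each xi equal to c contributes 2; so exactly
   one xi equals c. *)
by move: vnorm; rewrite w1 w2 !vd; case: (x1 == c); case: (x2 == c); case: (x3 == c).
Qed.

Lemma third_point (l : {poly K}) (x1 x2 : K) : (size l <= 2)%N ->
  ('X - x1%:P) * ('X - x2%:P) %| wpoly l ->
  exists k x3, k != 0 /\ wpoly l = k%:P * (('X - x1%:P) * ('X - x2%:P) * ('X - x3%:P)).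
Proof.
move=> sl /dvdpP [q Eq].
have sw : size (wpoly l) = 4%N.
  rewrite /wpoly addrC size_polyDl size_polyN size_g //.
  apply: leq_ltn_trans (size_polyD _ _) _; rewrite ltnS geq_max; apply/andP; split.
    by apply: leq_trans (size_polyMleq _ _) _; lia.
  by apply: leq_trans (size_polyMleq _ _) _; lia.
have q0 : q != 0 by apply/eqP => q0; move: sw; rewrite Eq q0 mul0r size_poly0.
have sq : size q = 2%N.
  have mon : ('X - x1%:P) * ('X - x2%:P) \is monic by rewrite monicMl ?monicXsubC.
  move: sw; rewrite Eq (size_Mmonic q0 mon).
  rewrite (size_Mmonic (negbT (polyXsubC_eq0 x1)) (monicXsubC x2)) !size_XsubC.
  by move: (size q) => n; lia.
pose k := q`_1; have k0 : k != 0.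
  by move: q0; rewrite -lead_coef_eq0 lead_coefE sq.
exists k, (- (q`_0 / k)); split=> //; rewrite Eq.
have {1}-> : q = k%:P * ('X - (- (q`_0 / k))%:P).
  apply/polyP => i; rewrite coefCM coefB coefX coefC.
  case: i => [|[|i]] /=.
  - by rewrite sub0r opprK mulrC divfK.
  - by rewrite subr0 mulr1.
  - by rewrite subrr mulr0 nth_default // sq.
by ring.
Qed.

(** * Linear equivalence of places and the group law *)

Lemma conj_point P (x0 w0 : K) : at_point P x0 w0 ->
  exists2 P', rational P' & at_point P' x0 (- h.[x0] - w0).
Proof.
move=> /at_point_on_curve E; apply: point_exists.
by rewrite /on_curve -E; ring.
Qed.

Lemma pval_infty_integral u : integral u -> u != 0 ->
  pval Qoo u <> -1 /\ (pval Qoo u = -2 -> exists2 a : {poly K}, size a = 2%N & u = ratfun L a).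
Proof.
move=> [a [b ->]] ab0; have ab : (a, b) != (0, 0).
  by apply: contraNneq ab0 => -[-> ->]; rewrite el0r rmorph0.
rewrite (Qoo_el ab) /degw; have [b0|b0] := eqVneq b 0; last first.
  by have : (0 < size b)%N by [rewrite size_poly_gt0]; move: (size a) (size b); split; lia.
have : (0 < size a)%N.
  by rewrite size_poly_gt0; apply: contraNneq ab => a0; rewrite a0 b0.
rewrite maxn0; split; first by lia.
by move=> sa; exists a; [lia|rewrite b0 el0r].
Qed.

(** [Qoo] enters sums as the default value of [padd], not as a place shown to be rational; hence the
    disjunction. *)
Definition rational_or_infty P := rational P \/ P = Qoo.

(* A function with a single simple pole would be a coordinate on a line. *)
Lemma rational_place_class_inj P P' u : rational_or_infty P -> rational_or_infty P' ->
  u != 0 -> (forall v : place L, pval v u = (P == v)%:R - (P' == v)%:R) -> P = P'.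
Proof.
move=> rP rP' u0 hu; apply: contrapT => /eqP/negbTE ne.
have [eQ'|/eqP nQ'] := eqVneq P' Qoo.
  have [|nm1 _] := @pval_infty_integral u _ u0.
    apply: integral_of_vge0 => v /eqP; rewrite eq_sym => /negbTE nv.
    by right; rewrite hu eQ' nv subr0; case: eqP.
  by apply: nm1; rewrite hu eQ' eqxx -eQ' ne.
have [eQ|/eqP nQ] := eqVneq P Qoo.
  have [|nm1 _] := @pval_infty_integral u^-1 _ (invr_neq0 u0).
    apply: integral_of_vge0 => v /eqP; rewrite eq_sym => /negbTE nv.
    by right; rewrite pvalV hu eQ nv sub0r opprK; case: eqP.
  by apply: nm1; rewrite pvalV hu eQ eqxx -eQ eq_sym ne.
(* Multiplying by x - x1 replaces the pole at P' by a double pole at [Qoo] and a zero at the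
   conjugate P1. The product is then a linear polynomial in x vanishing at x1, which makes u
   constant. *)
have ratP' : rational P' by case: rP'.
have hP' := rational_at_point ratP' nQ'; have [P1 _ hP1] := conj_point hP'.
set x1 := value_at P' x in hP' hP1.
have x10 := x_sub_neq0 x1; have ux0 := mulf_neq0 u0 x10.
have vux (v : place L) : pval v (u * (x - const L x1)) =
    (P == v)%:R + (P1 == v)%:R - (Qoo == v)%:R *+ 2.
  by rewrite pvalM // hu (div_x_sub v hP' hP1); ring.
have [|_] := @pval_infty_integral _ _ ux0.
  apply: integral_of_vge0 => v /eqP; rewrite eq_sym => /negbTE nv.
  by right; rewrite vux nv mul0rn subr0; case: (P == v); case: (P1 == v).
have /eqP/negbTE nQ1 := at_point_neq_infty hP1.
rewrite vux eqxx nQ1; move/eqP/negbTE: nQ => -> /(_ erefl) [a sa Ea].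
have : vge P1 1 (u * (x - const L x1)).
  by right; rewrite vux eqxx (eq_sym Qoo) nQ1; case: (P == P1).
rewrite Ea (at_point_ratfun _ hP1) => /eqP; rewrite -/(root a x1) -dvdp_XsubCl.
case/dvdpP => q Eq; have q0 : q != 0.
  by apply/eqP => q0; move: sa; rewrite Eq q0 mul0r size_poly0.
have /size_poly1P [c c0 qc] : size q == 1%N.
  by move: sa; rewrite Eq (size_Mmonic q0 (monicXsubC x1)) size_XsubC addn2 => -[->].
move: Ea; rewrite Eq ratfunM ratfun_XsubC => /(mulIf x10) uc.
by have := hu P; rewrite eqxx eq_sym ne uc qc (pval_const P c).
Qed.

(** If the set of candidates is inhabited, the chosen place is equivalent to R, hence equal to it.
    If it is empty, R is not rational, so R is [Qoo], the default. *)
Lemma padd_unique P1 P2 R u : rational_or_infty R -> u != 0 ->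
  (forall v : place L,
     pval v u = (P1 == v)%:R + (P2 == v)%:R - (R == v)%:R - (Qoo == v)%:R) ->
  padd Qoo P1 P2 = R.
Proof.
move=> rR u0 hu; rewrite /padd.
set A : set (place L) := mkset _.
have [[R' AR']|nA] := pselect (exists R', A R').
  have [rat [u' u'0 hu']] : A (xget Qoo A) by apply: xgetI AR'.
  apply: (@rational_place_class_inj _ _ (u / u')) => //; first by left.
    by rewrite mulf_neq0 ?invr_eq0.
  move=> v; rewrite pval_div // hu -hu' /pclass.
  by rewrite !(coeffB, coeffD) !coeffU !mul1r; ring.
rewrite xgetPN; last by move=> R' AR'; apply: nA; exists R'.
case: rR => // ratR; case: nA; exists R; split=> //; exists u => // v.
by rewrite hu /pclass !(coeffB, coeffD) !coeffU !mul1r; ring.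
Qed.

Lemma chord_dvdp (l : {poly K}) (x1 x2 w1 w2 : K) :
  on_curve x1 w1 -> on_curve x2 w2 -> l.[x1] = w1 -> l.[x2] = w2 -> x1 != x2 ->
  ('X - x1%:P) * ('X - x2%:P) %| wpoly l.
Proof.
move=> c1 c2 l1 l2 ne; rewrite Gauss_dvdp.
  by rewrite !dvdp_XsubCl /root !wpoly_horner l1 l2 c1 c2 eqxx.
by rewrite coprimep_XsubC root_XsubC eq_sym.
Qed.

(** The last hypothesis says that the derivative of [wpoly l] vanishes at x1, so x1 is a double
    root. *)
Lemma tangent_dvdp (l : {poly K}) (x1 w1 : K) : on_curve x1 w1 -> l.[x1] = w1 ->
  l^`().[x1] * (w1 *+ 2 + h.[x1]) + h^`().[x1] * w1 - g^`().[x1] = 0 ->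
  ('X - x1%:P) * ('X - x1%:P) %| wpoly l.
Proof.
move=> c1 l1 d1.
have /dvdpP [q Eq] : 'X - x1%:P %| wpoly l.
  by rewrite dvdp_XsubCl /root wpoly_horner l1 c1.
rewrite Eq dvdp_mul2r ?polyXsubC_eq0 // dvdp_XsubCl /root.
have := congr1 (fun p => p^`().[x1]) Eq.
rewrite derivM derivXsubC !hornerE /= subrr mulr0 add0r => <-.
rewrite -d1 /wpoly expr2 derivB derivD !derivM !(hornerD, hornerN, hornerM) l1.
by rewrite mulr2n; apply/eqP; ring.
Qed.

(* [w = l(x)] meets the curve at [P1], [P2] and the place opposite to their sum. *)
Lemma chord_sum (l : {poly K}) (x1 x2 : K) P1 P2 : (size l <= 2)%N ->
  at_point P1 x1 l.[x1] -> at_point P2 x2 l.[x2] ->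
  ('X - x1%:P) * ('X - x2%:P) %| wpoly l ->
  let R := padd Qoo P1 P2 in [/\ rational R, R <> Qoo &
    forall v : place L, pval v ((x - const L (value_at R x)) / (w - ratfun L l)) =
      (R == v)%:R + (Qoo == v)%:R - (P1 == v)%:R - (P2 == v)%:R].
Proof.
move=> sl h1 h2 /(third_point sl) [k [x3 [k0 E]]] /=.
have root3 : on_curve x3 l.[x3].
  by rewrite /on_curve -wpoly_horner E !hornerM [('X - x3%:P).[x3]]hornerXsubC subrr !mulr0.
have [S _ hS] := point_exists root3; have [R ratR hR] := conj_point hS.
have nR := at_point_neq_infty hR.
have wl0 := w_sub_neq0 l; have x30 := x_sub_neq0 x3.
have dv (v : place L) : pval v ((w - ratfun L l) / (x - const L x3)) =
    (P1 == v)%:R + (P2 == v)%:R - (R == v)%:R - (Qoo == v)%:R.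
  by rewrite pval_div // (div_line v sl k0 E h1 h2 hS) (div_x_sub v hS hR); ring.
have -> : padd Qoo P1 P2 = R.
  apply: (padd_unique _ _ dv); first by left.
  by rewrite mulf_neq0 ?invr_eq0.
split=> // v; have [-> _] := at_point_value hR.
by rewrite -[_ / _]invrK invfM invrK mulrC pvalV dv; ring.
Qed.

(* [is_line] for the Weierstrass model [w^2 + h w = g]. *)
Definition line_through P1 P2 (l : L) : Prop :=
  exists a b c : K,
    [/\ l = const L a * x + const L b * w + const L c,
        (a, b, c) != (0, 0, 0)
      & if padd Qoo P1 P2 == Qoo then b = 0 /\ c = - a * value_at P1 x
        else if P1 == P2 then
          a * value_at P1 x + b * value_at P1 w + c = 0 /\
          a * (value_at P1 w *+ 2 + h.[value_at P1 x]) =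
          b * (h^`().[value_at P1 x] * value_at P1 w - g^`().[value_at P1 x])
        else a * value_at P1 x + b * value_at P1 w + c = 0 /\
          a * value_at P2 x + b * value_at P2 w + c = 0].

Lemma line_through_div P1 P2 l : rational P1 -> rational P2 -> P1 <> Qoo -> P2 <> Qoo ->
  line_through P1 P2 l ->
  let R := padd Qoo P1 P2 in
  let F := if R == Qoo then l^-1 else (x - const L (value_at R x)) / l in
  [/\ rational_or_infty R, F != 0 & forall v : place L,
    pval v F = (R == v)%:R + (Qoo == v)%:R - (P1 == v)%:R - (P2 == v)%:R].
Proof.
move=> rat1 rat2 n1 n2 [a [b [c [El abc]]]] + R; rewrite -/R.
have h1 := rational_at_point rat1 n1; have h2 := rational_at_point rat2 n2.
set x1 := value_at P1 x in h1 *; set w1 := value_at P1 w in h1 *.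
set x2 := value_at P2 x in h2 *; set w2 := value_at P2 w in h2 *.
have c1 := at_point_on_curve h1; have c2 := at_point_on_curve h2.
(* Opposite points: the vertical line alone shows that the sum is [Qoo]. *)
have [[ex ew]|nv] := pselect (x2 = x1 /\ w2 = - h.[x1] - w1).
  have h2' : at_point P2 x1 (- h.[x1] - w1) by rewrite -ew -ex.
  have ER : R = Qoo.
    apply: (@padd_unique _ _ _ (x - const L x1)); [by right|exact: x_sub_neq0|].
    by move=> v; rewrite (div_x_sub v h1 h2'); ring.
  rewrite ER eqxx => -[b0 Ec] /=.
  have a0 : a != 0.
    by apply: contraNneq abc => a0; rewrite b0 Ec a0 oppr0 mul0r.
  have lE : l = const L a * (x - const L x1).
    by rewrite El b0 Ec /const polyC0 rmorph0 polyCM polyCN rmorphM rmorphN; ring.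
  have aL0 : const L a != 0 by rewrite const_eq0.
  have l0 : l != 0 by rewrite lE mulf_neq0 // x_sub_neq0.
  split; [by right|by rewrite invr_eq0|move=> v].
  rewrite pvalV lE (pvalM v aL0 (x_sub_neq0 x1)) (pval_const v a).
  by rewrite (div_x_sub v h1 h2'); ring.
have x12 : P1 != P2 -> x1 != x2.
  move=> ne; apply/eqP => ex; apply: nv; split=> //.
  have hx : vge P2 1 (x - const L x1) by rewrite ex; case/at_pointE: h2.
  have [hP|hP] := at_point_conj c1 hx.
    by case/eqP: ne; apply: at_point_unique h1 hP.
  by have [_ ->] := at_point_inj h2 hP.
have unr : P1 = P2 -> w1 *+ 2 + h.[x1] != 0.
  move=> e; apply/negP => ram; apply: nv; rewrite /x2 /w2 -e; split=> //.
  by apply/esym/eqP; rewrite conj_eq.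
have size_line (s t : K) : (size (s *: 'X + t%:P)%R <= 2)%N.
  apply: leq_trans (size_polyD _ _) _; rewrite geq_max size_polyC.
  by rewrite (leq_trans (size_scale_leq _ _)) ?size_polyX //; case: (t != 0).
have eline (s t z : K) : (s *: 'X + t%:P).[z] = s * z + t.
  by rewrite hornerD hornerZ hornerX hornerC.
have dline (s t : K) : (s *: 'X + t%:P)^`() = s%:P.
  by rewrite derivD derivC derivZ derivX addr0 alg_polyC.
have sum (s t : K) : (s *: 'X + t%:P).[x1] = w1 -> (s *: 'X + t%:P).[x2] = w2 ->
    (P1 = P2 -> s * (w1 *+ 2 + h.[x1]) + h^`().[x1] * w1 - g^`().[x1] = 0) ->
    [/\ rational R, R <> Qoo & forall v : place L,
      pval v ((x - const L (value_at R x)) / (w - ratfun L (s *: 'X + t%:P))) =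
      (R == v)%:R + (Qoo == v)%:R - (P1 == v)%:R - (P2 == v)%:R].
  move=> e1 e2 tan; apply: (@chord_sum _ x1 x2); rewrite ?e1 ?e2 //.
  have [e|ne] := eqVneq P1 P2; last exact: chord_dvdp c1 c2 e1 e2 (x12 ne).
  rewrite /x2 -e -/x1; apply: (tangent_dvdp c1) => //.
  by rewrite dline hornerC; apply: tan.
(* The condition on l depends on whether R is [Qoo], so this is settled first, using the chord or
   tangent with explicit slope s. *)
have nR : R != Qoo.
  have [e|ne] := eqVneq P1 P2.
    pose s := (g^`().[x1] - h^`().[x1] * w1) / (w1 *+ 2 + h.[x1]).
    have [||_|_ /eqP //] := sum s (w1 - s * x1).
    - by rewrite eline; ring.
    - by rewrite /x2 /w2 -e -/x1 -/w1 eline; ring.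
    - by rewrite /s divfK ?unr //; ring.
  have x21 : x2 - x1 != 0 by rewrite subr_eq0 eq_sym x12.
  pose s := (w2 - w1) / (x2 - x1).
  have [||e|_ /eqP //] := sum s (w1 - s * x1).
  - by rewrite eline; ring.
  - rewrite eline; transitivity (s * (x2 - x1) + w1); first by ring.
    by rewrite /s divfK //; ring.
  - by rewrite e eqxx in ne.
rewrite (negbTE nR) => cond.
have cond1 : a * x1 + b * w1 + c = 0 by move: cond; case: eqP => _ [].
have cond2 : a * x2 + b * w2 + c = 0.
  by move: cond; case: eqP => [e [H _]|_ []] //; rewrite /x2 /w2 -e.
(* A vertical l would give x1 = x2 for distinct points, or 2 w1 + h(x1) = 0 for a tangent; both
   belong to the excluded case of opposite points. *)
have b0 : b != 0.
  apply/eqP => b0; move: cond1 cond2 cond; rewrite b0 !mul0r !addr0 => e1 e2.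
  have a0 : a != 0.
    by apply: contraNneq abc => a0; move: e1; rewrite a0 b0 mul0r add0r => ->.
  have [e [_ /eqP]|ne _] := eqVneq P1 P2.
    by rewrite mulf_eq0 (negbTE a0) (negbTE (unr e)).
  case/eqP: (x12 ne); apply: (mulfI a0); apply: (addIr c); by rewrite e1 e2.
pose s := - a / b; pose t := - c / b.
have on (x0 w0 : K) : a * x0 + b * w0 + c = 0 -> (s *: 'X + t%:P).[x0] = w0.
  move=> e; rewrite eline; apply: (mulfI b0).
  transitivity (b * w0 - (a * x0 + b * w0 + c)); last by rewrite e subr0.
  by rewrite /s /t; field.
have tan : P1 = P2 -> s * (w1 *+ 2 + h.[x1]) + h^`().[x1] * w1 - g^`().[x1] = 0.
  move=> e; move: cond; rewrite e eqxx => -[_ E].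
  apply: (mulfI b0); rewrite mulr0.
  transitivity (- (a * (w1 *+ 2 + h.[x1])) + b * (h^`().[x1] * w1 - g^`().[x1])).
    by rewrite /s; field.
  by rewrite E addNr.
have [ratR _ dv] := sum s t (on _ _ cond1) (on _ _ cond2) tan.
have bL0 : const L b != 0 by rewrite const_eq0.
have lE : l = const L b * (w - ratfun L (s *: 'X + t%:P)).
  have sb : const L b * const L s = - const L a.
    by rewrite /const -ratfunM -polyCM /s mulrC divfK // polyCN rmorphN.
  have tb : const L b * const L t = - const L c.
    by rewrite /const -ratfunM -polyCM /t mulrC divfK // polyCN rmorphN.
  have -> : ratfun L (s *: 'X + t%:P) = const L s * x + const L t.
    by rewrite -mul_polyC rmorphD rmorphM.
  rewrite El.
  transitivity (const L b * w - (const L b * const L s * x + const L b * const L t)).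
    by rewrite sb tb; ring.
  by ring.
have wl0 := w_sub_neq0 (s *: 'X + t%:P); have xR0 := x_sub_neq0 (value_at R x).
have l0 : l != 0 by rewrite lE mulf_neq0.
split; [by left|by rewrite mulf_neq0 ?invr_eq0|move=> v].
rewrite -dv !pval_div // lE (pvalM v bL0 wl0) (pval_const v b); ring.
Qed.

(** * Global constants and the Riemann-Roch space of n P - n [Qoo] *)

Lemma constant_of_vge0 u : (forall P, vge P 0 u) -> exists c, u = const L c.
Proof.
move=> H; have [a [b Eu]] : integral u by apply: integral_of_vge0.
have [u0|u0] := eqVneq u 0; first by exists 0; rewrite u0 /const polyC0 rmorph0.
have ab : (a, b) != (0, 0).
  by apply: contraNneq u0 => -[a0 b0]; rewrite Eu a0 b0 el0r rmorph0.
have := H Qoo; rewrite vgeE // Eu (Qoo_el ab) /degw; have [b0|b0] := eqVneq b 0.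
  rewrite maxn0 => sa; have /size1_polyC Ea : (size a <= 1)%N by lia.
  by exists a`_0; rewrite b0 el0r {1}Ea.
by have : (0 < size b)%N by [rewrite size_poly_gt0]; move: (size a) (size b); lia.
Qed.

Lemma padd_infty P : rational_or_infty P -> padd Qoo P Qoo = P.
Proof.
move=> rP; apply: (@padd_unique _ _ _ 1) => [//||v]; first exact: oner_neq0.
by rewrite pval1; ring.
Qed.

Lemma padd_inftyl P : rational_or_infty P -> padd Qoo Qoo P = P.
Proof.
move=> rP; apply: (@padd_unique _ _ _ 1) => [//||v]; first exact: oner_neq0.
by rewrite pval1; ring.
Qed.

Lemma pmul_riemann_roch P (F : place L -> L) (n : nat) : rational P ->
  (forall Q, rational_or_infty Q -> let R := padd Qoo P Q in
    [/\ rational_or_infty R, F Q != 0 & forall v : place L,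
      pval v (F Q) = (R == v)%:R + (Qoo == v)%:R - (P == v)%:R - (Q == v)%:R]) ->
  (1 <= n)%N ->
  pmul Qoo n P = Qoo <->
  riemann_roch (<< P >> *+ n - << Qoo >> *+ n) =
    Kspan1 (\prod_(1 <= k < n) F (pmul Qoo k P)).
Proof.
move=> ratP Fdiv n1.
have ratM k : rational_or_infty (pmul Qoo k P).
  by elim: k => [|k IH]; [right|case: (Fdiv _ IH)].
have F0 k : F (pmul Qoo k P) != 0 by case: (Fdiv _ (ratM k)).
set G := \prod_(1 <= k < n) _.
have G0 : G != 0 by rewrite prodf_seq_neq0; apply/allP => k _; apply: F0.
have vG (v : place L) : pval v G =
    (pmul Qoo n P == v)%:R + (Qoo == v)%:R *+ n.-1 - (P == v)%:R *+ n.
  (* The induction starts at the empty product for n = 1, where 1 P = P makes the divisor zero. *)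
  rewrite /G; case: n n1 {G G0} => // n _; elim: n => [|n IH].
    by rewrite big_geq // pval1 /pmul /= (padd_infty (or_introl ratP)); ring.
  have [_ Fn0 vF] := Fdiv _ (ratM n.+1).
  rewrite big_nat_recr //= pvalM //; last first.
    by rewrite prodf_seq_neq0; apply/allP => k _; apply: F0.
  by rewrite IH vF /= !mulrS; ring.
have coeffE (v : place L) : coeff v (<< P >> *+ n - << Qoo >> *+ n) =
    (P == v)%:R *+ n - (Qoo == v)%:R *+ n.
  by rewrite coeffB !coeffMn !coeffU !mul1r.
split=> [nP|E]; last first.
  have : Kspan1 G G by exists 1 => //; rewrite /const rmorph1 mul1r.
  rewrite -E => -[/eqP|/(_ Qoo)]; first by rewrite (negbTE G0).
  have bMn (b : bool) (k : nat) : b%:R *+ k = (b * k)%N%:Z.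
    by case: b; rewrite ?mul0rn ?mul1n ?natz.
  (* If n P is not [Qoo], the value of G at [Qoo] is exactly one less than membership requires, also
     when P = [Qoo]. *)
  rewrite coeffE vG eqxx !bMn; case: (pmul Qoo n P =P Qoo) => // _.
  by case: (P == Qoo); lia.
have vG' (v : place L) : pval v G = (Qoo == v)%:R *+ n - (P == v)%:R *+ n.
  by rewrite vG nP; case: n n1 {G G0 vG coeffE nP} => // n _; rewrite /= mulrS; ring.
apply/seteqP; split=> u.
  case=> [->|hu]; first by exists 0 => //; rewrite /const polyC0 rmorph0 mul0r.
  have [|c Ec] := @constant_of_vge0 (u / G).
    move=> v; have [->|u0] := eqVneq u 0; first by left; rewrite mul0r.
    by right; rewrite pval_div // vG'; have := hu v; rewrite coeffE; lia.
  by exists c => //; rewrite -Ec divfK.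
case=> c _ <-; have [->|c0] := eqVneq c 0.
  by left; rewrite /const polyC0 rmorph0 mul0r.
have cL0 : const L c != 0 by rewrite const_eq0.
right=> v; rewrite (pvalM v cL0 G0) (pval_const v c) vG' coeffE; lia.
Qed.

End Weierstrass.

(** * The three curve equations *)

Section CurveEquations.
Variables (K : finFieldType) (L : fieldExtType {fraction {poly K}}).
Variables (E : curve_equation K) (y : L).
Hypothesis E_adm : admissible E.
Local Notation h := (weier_h E).
Local Notation g := (weier_g E).
Local Notation w := (coord_w E y).

Lemma size_linear (a b : K) : a != 0 -> size (a *: 'X + b%:P) = 2%N.
Proof.
move=> a0; rewrite size_polyDl size_scale // size_polyX // size_polyC.
by case: (b != 0).
Qed.

Lemma size_weier_h : (size h <= 2)%N.
Proof.
case: E E_adm => [f|f|a b] /= adm; rewrite ?size_poly0 ?size_poly1 //.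
by rewrite size_linear //; case: adm.
Qed.

Lemma size_weier_g : size g = 4%N.
Proof.
case: E E_adm => [f []|f []|a b [_ a0]] //=; set A := a *: 'X + b%:P.
have sA : size A = 2%N := size_linear b a0.
have A0 : A != 0 by rewrite -size_poly_gt0 sA.
have sA2 : size (A ^+ 2) = 3%N by rewrite expr2 size_mul // sA.
rewrite size_polyDl size_mul ?polyX_eq0 ?expf_neq0 // size_polyX sA2 //.
by rewrite sA.
Qed.

Lemma poly_mulr2_pchar2 (a : {poly K}) : 2%N \in [pchar K] -> a *+ 2 = 0.
Proof. by move=> c2; rewrite -scaler_nat (pcharf0 c2) scale0r. Qed.

(** For y^2 = f, p divides w0, so p^2 | [wpoly] would give p^2 | f against square-freeness. For y^2
    + y = f, 2 w0 + h = 1 excludes ramification. For the last equation p divides both A = a x + b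
    and w0, and p^2 | [wpoly] would give p^2 | A, although A has degree 1. *)
Lemma weier_smooth p (w0 : {poly K}) : irreducible_poly p -> p %| w0 *+ 2 + h ->
  p %| wpoly h g w0 -> ~~ (p ^+ 2 %| wpoly h g w0).
Proof.
rewrite /wpoly => irr; have [p1 _] := irr.
case: E E_adm => [f [c2 _ sqf]|f [c2 _]|a b [c2 a0]] /=; last first.
- rewrite poly_mulr2_pchar2 // add0r; set A := a *: 'X + b%:P => pA pF.
  have A0 : A != 0 by rewrite -size_poly_gt0 size_linear.
  have pw : p %| w0.
    suff : p %| w0 * w0 by move/(irredp_dvdM irr)/orP => [].
    have -> : w0 * w0 = (w0 ^+ 2 + A * w0 - ('X * A ^+ 2 + A)) + A * ('X * A + 1 - w0) by ring.
    by apply: dvdp_add => //; apply: dvdp_mulr.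
  have p2 u v : p %| u -> p %| v -> p ^+ 2 %| u * v by move=> *; rewrite expr2 dvdp_mul.
  apply/negP => p2F; have : p ^+ 2 %| A.
    have -> : A = w0 * w0 + A * w0 - 'X * (A * A) - (w0 ^+ 2 + A * w0 - ('X * A ^+ 2 + A)).
      by ring.
    apply: dvdp_sub => //; apply: dvdp_sub; last by apply: dvdp_mull; apply: p2.
    by apply: dvdp_add; apply: p2.
  move/(dvdp_leq A0); rewrite size_linear // expr2 size_mul ?irredp_neq0 //.
  by move: p1; move: (size p) => n; lia.
- by rewrite poly_mulr2_pchar2 // add0r => /(elimN idP (irredp_ndvd1 irr)).
- rewrite addr0 mul0r addr0 => p2w pF; have pw : p %| w0.
    by move: p2w; rewrite -scaler_nat dvdpZr.
  have := sqf p p1; apply: contra => p2F.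
  have -> : f = w0 ^+ 2 - (w0 ^+ 2 - f) by ring.
  by apply: dvdp_sub => //; rewrite !expr2 dvdp_mul.
Qed.

Lemma w_factor_neq0 : w_factor E != 0.
Proof.
case: E E_adm => [f|f|a b [_ a0]] /=; rewrite ?oner_eq0 //.
by rewrite -size_poly_gt0 size_linear.
Qed.

Lemma coord_w_eq : satisfies_equation E y -> w ^+ 2 + ratfun L h * w = ratfun L g.
Proof.
rewrite /coord_w; have := w_factor_neq0; case: E => [f|f|a b] /= wf0.
- by rewrite rmorph1 rmorph0 mul1r mul0r addr0.
- by rewrite rmorph1 !mul1r.
set A := a *: 'X + b%:P in wf0 *; move=> Ey.
have EA : ratfun L A = const L a * varx L + const L b.
  by rewrite /A -mul_polyC rmorphD rmorphM.
have A0 : ratfun L A != 0 by rewrite ratfun_eq0.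
rewrite -EA in Ey.
have -> : ratfun L ('X * A ^+ 2 + A) = varx L * ratfun L A ^+ 2 + ratfun L A.
  by rewrite rmorphD rmorphM rmorphXn.
transitivity (ratfun L A ^+ 2 * (y ^+ 2 + y)); first by ring.
by rewrite Ey; field.
Qed.

(** The fractions (a + b w) / d form a ring containing K(x) and y, and every element of L is a
    polynomial in y over K(x). *)
Lemma coord_w_gen : satisfies_equation E y -> <<1; y>>%VS = fullv ->
  forall u, exists a b d, d != 0 /\ u = el w a b / ratfun L d.
Proof.
move=> Ey full u; have rN0 d : d != 0 -> ratfun L d != 0 by rewrite ratfun_eq0.
pose G v := exists a b d, d != 0 /\ v = el w a b / ratfun L d.
have GD v v' : G v -> G v' -> G (v + v').
  move=> [a [b [d [d0 ->]]]] [a' [b' [d' [d0' ->]]]].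
  exists (a * d' + a' * d), (b * d' + b' * d), (d * d'); split; first exact: mulf_neq0.
  rewrite /el ratfunM !(rmorphD, rmorphM) /=; field.
  by rewrite !rN0.
have Gf (f : {fraction {poly K}}) : G f%:A.
  have [n [d [d0 E1]]] := fraction_ratio f; exists n, 0, d; split=> //.
  rewrite el0r; apply: (mulIf (rN0 d d0)); rewrite divfK ?rN0 //.
  by rewrite /ratfun -E1 -scalerAl mul1r scalerA.
have GM v v' : G v -> G v' -> G (v * v').
  move=> [a [b [d [d0 ->]]]] [a' [b' [d' [d0' ->]]]].
  have Ew := coord_w_eq Ey.
  exists (a * a' + b * b' * g), (a * b' + b * a' - b * b' * h), (d * d').
  split; first exact: mulf_neq0.
  by rewrite -(elM Ew) ratfunM; field; rewrite !rN0.
have Gy : G y.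
  exists 0, 1, (w_factor E); split; first exact: w_factor_neq0.
  by rewrite /el rmorph0 rmorph1 add0r mul1r /coord_w mulrAC divff ?mul1r ?rN0 ?w_factor_neq0.
have : u \in <<1; y>>%VS by rewrite full memvf.
case/Fadjoin_polyP => q /polyOver1P [q' ->] ->.
elim/poly_ind: q' => [|q' c IH].
  by have := Gf 0; rewrite rmorph0 horner0 scale0r.
rewrite rmorphD rmorphM /= map_polyX map_polyC hornerD hornerM hornerX hornerC.
by apply: GD (Gf c); apply: GM.
Qed.

End CurveEquations.

Theorem theorem2p2 (K : finFieldType) (L : fieldExtType {fraction {poly K}})
    (E : curve_equation K) (y : L) (hE : elliptic_function_field E y)
    (Qoo : place L) (hQoo : common_pole y Qoo)
    (m : place L -> place L -> L) (hm : line_choice E y Qoo m)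
    (P : place L) (hP : rational P) (n : nat) (hn : (1 <= n)%N) :
  pmul Qoo n P = Qoo <->
  riemann_roch (<< P >> *+ n - << Qoo >> *+ n) =
    Kspan1 (\prod_(1 <= k < n) Ffun Qoo m P (pmul Qoo k P)).
Proof.
have [adm Ey full] := hE; have [xQ _] := hQoo.
have w_eq := coord_w_eq adm Ey; have gen := coord_w_gen adm Ey full.
have sh := size_weier_h adm; have sg := size_weier_g adm.
have smooth := weier_smooth adm.
apply: (pmul_riemann_roch w_eq sh sg xQ gen smooth (F := Ffun Qoo m P) hP) => // Q rQ R.
rewrite /Ffun -/R; have [eP|nP] := eqVneq P Qoo.
  rewrite /= oner_eq0 /R eP (padd_inftyl w_eq sh sg xQ gen smooth rQ).
  by split=> // v; rewrite pval1; ring.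
have [eQ|nQ] := eqVneq Q Qoo.
  rewrite /= oner_eq0 /R eQ (padd_infty w_eq sh sg xQ gen smooth (or_introl hP)).
  by split=> [|//|v]; [left|rewrite pval1; ring].
have ratQ : rational Q by case: rQ => // eQ; rewrite eQ eqxx in nQ.
have nP' : P <> Qoo by apply/eqP.
have nQ' : Q <> Qoo by apply/eqP.
(* With w = [coord_w E y], [is_line] unfolds to [line_through], so any admissible choice of lines is
   covered. *)
exact: (line_through_div w_eq sh sg xQ gen smooth hP ratQ nP' nQ'
  (hm P Q hP ratQ nP' nQ')).
Qed.
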